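(* Let $q\in(1,\infty]$, $r\in\mathbb{N}$ and $a\in(0,1)$. Then integration in the tensor product space $W_{a,q}^{(r,r,\ldots,r)}([0,1]^d)$ suffers from the curse of dimensionality. In more detail, $$N(\varepsilon,d)\ge C_{p,r}^d\,(1-\varepsilon)\quad\text{for all }\varepsilon\in(0,1)\text{ and }d\in\mathbb{N},$$ where $p$ is the Hölder conjugate of $q$ (i.e. $1/p+1/q=1$) and $$C_{p,r}=1+\left(\frac{1}{\max(a,1-a)}-1\right)^{rp+1}>1.$$
   Context: $\mathbb{N}=\{1,2,\dots\}$. For $d=1$, $W_{a,q}^{r}([0,1])$ is the space of all $f:[0,1]\to\mathbb{R}$ such that $f^{(j)}(a)=0$ for $0\le j<r$, $f^{(r-1)}$ is absolutely continuous and $f^{(r)}\in L_q([0,1])$, with norm $\|f\|_{1,q}=\|f^{(r)}\|_{L_q}$. The space $F_d=W_{a,q}^{(r,\ldots,r)}([0,1]^d)$ is the $d$-fold tensor product of $W_{a,q}^r([0,1])$ with itself, equipped with the crossnorm $\|f\|_{d,q}=\|f^{(r,r,\ldots,r)}\|_{L_q}$, where $f^{(r,\ldots,r)}$ is the mixed partial derivative of order $r$ in each variable and the $L_q$-norm is over $[0,1]^d$. Integration: $I_d(f)=\int_{[0,1]^d}f(\boldsymbol{x})\,\mathrm{d}\boldsymbol{x}$. Initial error: $e(0,d)=\sup\{|I_d(f)|: f\in F_d,\ \|f\|_{d,q}\le1\}$. A linear algorithm is $A_{d,N}(f)=\sum_{k=1}^Na_kf(\boldsymbol{x}_k)$ with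 $\boldsymbol{x}_k\in[0,1]^d$, $a_k\in\mathbb{R}$; its worst-case error is $e(F_d,A_{d,N})=\sup\{|I_d(f)-A_{d,N}(f)|: f\in F_d,\ \|f\|_{d,q}\le1\}$; $e(N,d)$ is the infimum of this over all linear algorithms using $N$ nodes; $N(\varepsilon,d)=\min\{N\in\mathbb{N}: e(N,d)\le\varepsilon\,e(0,d)\}$ ($=\infty$ if no such $N$ exists). Curse of dimensionality: for some fixed $\varepsilon>0$, $N(\varepsilon,d)$ grows at least exponentially fast in $d$. *)

(* Defs.v *)
(* MathComp-Analysis, over an arbitrary [R : realType]. *)
From HB Require Import structures.
From mathcomp Require Import all_boot all_order all_algebra.
From mathcomp Require Import all_classical all_reals all_analysis.

Set Implicit Arguments.
Unset Strict Implicit.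
Unset Printing Implicit Defensive.

Import Order.TTheory GRing.Theory Num.Theory.
Import numFieldNormedType.Exports.

Local Open Scope classical_set_scope.
Local Open Scope ring_scope.

(* Functions on [0,1] and on [0,1]^d are represented by functions on the whole
   of R and R^d, of which no definition below reads a value outside [0,1] or
   [0,1]^d except on a null set.  The measures restrict Lebesgue measure to
   [0,1] and [0,1]^d but live on the whole space, because [Lnorm] ranges over
   the whole carrier. *)

Section measures.
Variable R : realType.

Definition leb01 : set (measurableTypeR R) -> \bar R :=
  mrestr lebesgue_measure (measurable_itv `[0, 1]%R).

HB.instance Definition _ := Measure.on leb01.

Lemma leb01_setT : leb01 setT = 1%E.
Proof.
by rewrite /leb01/= /mrestr setTI lebesgue_measure_itv/= lte01 oppr0 adde0.
Qed.

HB.instance Definition _ :=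
  Measure_isProbability.Build _ _ _ leb01 leb01_setT.

Definition tcons n (z : measurableTypeR R * n.-tuple (measurableTypeR R)) :
  n.+1.-tuple (measurableTypeR R) := [tuple of z.1 :: z.2].

Lemma measurable_tcons n : measurable_fun setT (@tcons n).
Proof. exact: measurable_cons. Qed.

HB.instance Definition _ n :=
  isMeasurableFun.Build _ _ _ _ (@tcons n) (@measurable_tcons n).

Fixpoint lebcube (d : nat) : probability (d.-tuple (measurableTypeR R)) R :=
  match d with
  | 0 => \d_([tuple])
  | n.+1 => distribution (leb01 \x lebcube n)%E (@tcons n)
  end.

Definition cube (d : nat) : set (d.-tuple (measurableTypeR R)) :=
  [set x | forall j, 0 <= tnth x j <= 1].

End measures.

Arguments leb01 : clear implicits.
Arguments lebcube : clear implicits.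
Arguments cube : clear implicits.

Section univariate.
Variable R : realType.
Implicit Types f g : R -> R.

(* Derivative of a function on [0,1]: one-sided at the endpoints. *)
Definition is_deriv01 f (x l : R) :=
  (f y - f x) / (y - x) @[y --> within `[0, 1] x^'] --> l.

Definition abs_continuous01 f :=
  forall e : R, 0 < e -> exists2 delta : R, 0 < delta &
    forall (n : nat) (u v : 'I_n -> R),
      (forall i, 0 <= u i /\ u i <= v i /\ v i <= 1) ->
      trivIset setT (fun i => `]u i, v i[%classic) ->
      \sum_(i < n) (v i - u i) < delta ->
      \sum_(i < n) `|f (v i) - f (u i)| < e.

(* [f] belongs to W^r_{a,q}([0,1]) and [g] is a (Borel, everywhere defined)
   representative of the class of f^(r) in L_q([0,1]); [D j] is f^(j). *)
Definition sobolev (a : R) (q : \bar R) (r : nat) f g :=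
  exists D : nat -> R -> R,
    [/\ forall x, 0 <= x <= 1 -> D 0 x = f x,
        forall j x, (j.+1 < r)%N -> 0 <= x <= 1 -> is_deriv01 (D j) x (D j.+1 x),
        forall j, (j < r)%N -> D j a = 0,
        abs_continuous01 (D r.-1) &
        (\forall x \ae leb01 R, is_deriv01 (D r.-1) x (g x)) /\
        (g : measurableTypeR R -> R) \in Lfun (leb01 R) q].

End univariate.

Section tensor_product.
Variable R : realType.
Variables (a : R) (q : \bar R) (r d : nat).
Local Notation pt := (d.-tuple (measurableTypeR R)).
Implicit Types f g : pt -> R.

(* Algebraic tensor product: finite sums of elementary tensors, for which
   f^(r,...,r) is the sum of the products of the univariate f^(r). *)
Definition alg_tensor f g :=
  exists (m : nat) (u v : 'I_m -> 'I_d -> R -> R),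
    [/\ forall i j, sobolev a q r (u i j) (v i j),
        forall x, cube R d x -> f x = \sum_(i < m) \prod_(j < d) u i j (tnth x j) &
        forall x, g x = \sum_(i < m) \prod_(j < d) v i j (tnth x j)].

(* Its completion in the norm |f^(r,...,r)|_{L_q}, realized as a space of
   functions: norm convergence dominates uniform convergence on the cube, so an
   element of the completion is the pointwise limit f of elementary sums whose
   mixed derivatives converge in L_q; the limit g of these is f^(r,...,r). *)
Definition tensor_space f g :=
  g \in Lfun (lebcube R d) q /\
  exists fn gn : nat -> pt -> R,
    [/\ forall n, alg_tensor (fn n) (gn n),
        'N[lebcube R d]_q[EFin \o (gn n \- g)%R]%E @[n --> \oo] --> 0%E &
        forall x, cube R d x -> fn n x @[n --> \oo] --> f x].

Definition unit_ball : set (pt -> R) :=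
  [set f | exists2 g, tensor_space f g & ('N[lebcube R d]_q[EFin \o g] <= 1)%E].

Definition integral_cube f : R := (\int[lebcube R d]_(x in cube R d) f x)%R.

Definition initial_error : \bar R :=
  ereal_sup [set (`|integral_cube f|)%:E | f in unit_ball].

Definition worst_case_error N (x : 'I_N -> pt) (c : 'I_N -> R) : \bar R :=
  ereal_sup
    [set (`|integral_cube f - \sum_(k < N) c k * f (x k)|)%:E
    | f in unit_ball].

Definition min_error (N : nat) : \bar R :=
  ereal_inf [set e | exists (x : 'I_N -> pt) (c : 'I_N -> R),
    (forall k, cube R d (x k)) /\ e = worst_case_error x c].

(* +oo when no N qualifies. *)
Definition information_complexity (eps : R) : \bar R :=
  ereal_inf [set N%:R%:E | N in
    [set N : nat | (0 < N)%N /\ (min_error N <= eps%:E * initial_error)%E]].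

End tensor_product.

Definition curse_of_dimensionality (R : realType) (Nc : R -> nat -> \bar R) :=
  exists eps c b : R, [/\ 0 < eps, 0 < c, 1 < b &
    forall d, (0 < d)%N -> ((c * b ^+ d)%:E <= Nc eps d)%E].

(* Main.v *)
(* Integrating Taylor's formula with integral remainder gives, in dimension one,
   I(f) = int K f^(r) with K(t) = (-t)^r / r! on [0, a[ and (1 - t)^r / r! on
   [a, 1]; in dimension d the functional is represented by the product kernel, so
   Hoelder's inequality bounds the initial error by ||K||_p^d.  Equality in
   Hoelder's inequality is attained by g = sgn(K) |K|^(p-1), and g = g_0 + g_1 with
   g_0, g_1 supported on either side of a; since the boundary conditions sit at a,
   their r-fold primitives are supported on either side of a as well.  Hence the
   extremal function is a sum of 2^d product splines with supports in the 2^d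
   orthants around (a, ..., a), and a node lies in the support of at most one of
   them.  Dropping the splines seen by N nodes leaves a function invisible to the
   algorithm, of no larger norm, and costs at most N max(k_0, k_1)^d out of
   (k_0 + k_1)^d in the integral, where k_b is the mass of |K|^p on side b; the
   ratio (k_0 + k_1) / max(k_0, k_1) is C_{p,r}. *)
Require Import Defs.
From mathcomp Require Import all_boot all_order all_algebra.
From mathcomp Require Import all_classical all_reals all_analysis.
From mathcomp Require Import measurable_realfun ess_sup_inf.
From mathcomp Require Import ring lra zify.
Import Order.TTheory GRing.Theory Num.Theory.
Import numFieldNormedType.Exports.
Local Open Scope classical_set_scope.
Local Open Scope ring_scope.

Set Implicit Arguments.
Unset Strict Implicit.
Unset Printing Implicit Defensive.

(** * Derivatives and absolute continuity on [0,1] *)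

(** The definitions give only pointwise data: one-sided derivatives on [0,1], an almost everywhere
    derivative at the top, and pointwise limits for the completion. Hence Taylor's formula must rest
    on a fundamental theorem of calculus for absolutely continuous functions. Its core, that a zero
    derivative almost everywhere forces constancy, is obtained by Cousin induction. For the
    completion, point evaluation, like integration, is a pairing of the mixed derivative with a
    kernel bounded by 1. So L_q convergence of the derivatives bounds the approximants uniformly,
    and the integral formula survives the limit. Only one-sided estimates are needed: the initial
    error is bounded above, the minimal error below, and the same power ||K||_p^d occurs in both. As
    for the constant, |K| is r!^-1 times the r-th power of the distance to 0 (left of [a]) or to 1
    (right of [a]). So k_0 and k_1 are a^(rp+1) and (1-a)^(rp+1) up to a common factor, and the
    smaller of a, 1-a divided by the larger is 1/max(a,1-a) - 1 because they add up to 1. *)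

Section real_induction.
Variable R : realType.

(* Cousin's lemma on gauge-fine partitions, as an induction principle. *)
Lemma cousin_ind (P : R -> Prop) (x0 x1 : R) : x0 <= x1 -> P x0 ->
  (forall c, x0 <= c <= x1 -> exists2 e : R, 0 < e &
    forall y z, x0 <= y -> y <= c -> c <= z -> z <= x1 -> z - y < e ->
      P y -> P z) ->
  P x1.
Proof.
move=> x01 P0 step.
pose S := [set y | x0 <= y <= x1 /\ P y].
have S0 : S x0 by split => //; rewrite lexx.
have ubS : ubound S x1 by move=> y [/andP[]].
have supS : has_sup S by split; [exists x0 | exists x1].
set c := sup S.
have x0c : x0 <= c by apply: ub_le_sup => //; exists x1.
have cx1 : c <= x1 by apply: ge_sup => //; exists x0.
have [|e e0 He] := step c; first by rewrite x0c.
have [y [/andP[x0y yx1] Py] cy] := sup_adherent e0 supS.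
have yc : y <= c by apply: ub_le_sup; [exists x1 | split => //; apply/andP].
rewrite -/c in cy.
have Pc : P c by apply: (He y c) => //; lra.
(* Half a gauge beyond the supremum [c], capped at [x1]. As [P z] holds, [z] cannot exceed [c], so
   the cap is attained. *)
pose z := Num.min (c + e / 2) x1.
have cz : c <= z by rewrite le_min cx1 andbT; lra.
have zx1 : z <= x1 by rewrite ge_min lexx orbT.
have ze : z <= c + e / 2 by rewrite ge_min lexx.
have Pz : P z by apply: (He c z) => //; lra.
have zc : z <= c.
  apply: ub_le_sup; first by exists x1.
  by split => //; rewrite zx1 andbT (le_trans x0c).
move: Pz; suff -> : z = x1 by [].
apply/eqP; rewrite eq_le zx1 /= le_min lexx andbT.
by move: zc; rewrite /z ge_min => /orP[|/le_trans];
  [lra | move=> /(_ (c + e/2)); apply; lra].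
Qed.

End real_induction.

Section derivatives.
Variable R : realType.
Implicit Types (f g : R -> R) (x l : R).

(** Clearing the denominator removes both the quotient and the punctured neighbourhood; at [y = x]
    the inequality is trivial. Estimates use this form, algebraic rules the limit form. *)
Lemma is_deriv01P f x l : is_deriv01 f x l <->
  forall e, 0 < e -> exists2 dl : R, 0 < dl & forall y, 0 <= y <= 1 ->
    `|y - x| < dl -> `|f y - f x - l * (y - x)| <= e * `|y - x|.
Proof.
split=> [/cvgrPdist_le H e /H | H].
  rewrite !near_withinE => /nbhs_ballP[d /= d0 Hd]; exists d => // y y01 yx.
  have [->|yx0] := eqVneq y x; first by rewrite !subrr mulr0 subr0 normr0 mulr0.
  have := Hd y _ yx0; rewrite in_itv/= => /(_ _ y01).
  rewrite /ball /= distrC => /(_ yx).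
  have yx0' : y - x != 0 by rewrite subr_eq0.
  rewrite -(@ler_pM2r _ `|y - x|) ?normr_gt0// -normrM. apply: le_trans.
  rewrite le_eqVlt -normrN; apply/orP; left; apply/eqP; congr (`|_|).
  by field.
apply/cvgrPdist_le => e /H[d d0 Hd].
rewrite !near_withinE; apply/nbhs_ballP; exists d => //= y + yx;
  rewrite in_itv/= /ball/= distrC => + y01 => /(Hd _ y01).
have yx0' : y - x != 0 by rewrite subr_eq0.
move=> H2; rewrite -(@ler_pM2r _ `|y - x|) ?normr_gt0// -normrM;
  apply: le_trans H2.
rewrite le_eqVlt -normrN; apply/orP; left; apply/eqP; congr (`|_|).
by field.
Qed.

Definition dnbhs01 x : set_system R := within `[0, 1] x^'.

#[local] Instance dnbhs01_filter x : Filter (dnbhs01 x).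
Proof. exact: within_filter. Qed.

Lemma is_deriv01E f x l : is_deriv01 f x l =
  ((f y - f x) / (y - x) @[y --> dnbhs01 x] --> l).
Proof. by []. Qed.

Lemma is_deriv01_cvg f x l : is_deriv01 f x l -> f y @[y --> dnbhs01 x] --> f x.
Proof.
rewrite is_deriv01E => fl.
have id0 : y - x @[y --> dnbhs01 x] --> 0.
  have idx : y @[y --> dnbhs01 x] --> x.
    exact: cvg_trans (cvg_within _) (@nbhs_dnbhs _ x).
  rewrite -[X in _ --> X](subrr x); apply: cvgB idx _; exact: cvg_cst.
have <- : l * 0 + f x = f x by rewrite mulr0 add0r.
apply: cvg_trans (cvgD (cvgM fl id0) (cvg_cst (f x))); apply: near_eq_cvg.
rewrite !near_withinE; near=> y => yx y01.
have yx0' : y - x != 0 by rewrite subr_eq0.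
change ((f y - f x) / (y - x) * (y - x) + f x = f y).
by rewrite divfK// subrK.
Unshelve. all: end_near. Qed.

Lemma is_deriv01_cst c x : is_deriv01 (fun=> c) x 0.
Proof. by apply/is_deriv01P => e e0; exists 1 => // y _ _;
  rewrite subrr mul0r subr0 normr0 mulr_ge0// ltW. Qed.

Lemma is_deriv01_subl c x : is_deriv01 (fun y => c - y) x (- 1).
Proof.
apply/is_deriv01P => e e0; exists 1 => // y _ _.
rewrite [X in `|X|](_ : _ = 0); last by ring.
by rewrite normr0 mulr_ge0// ltW.
Qed.

Lemma is_deriv01D f g x l m : is_deriv01 f x l -> is_deriv01 g x m ->
  is_deriv01 (fun y => f y + g y) x (l + m).
Proof.
rewrite !is_deriv01E => fl gm; apply: cvg_trans (cvgD fl gm);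
  apply: near_eq_cvg.
apply: nearW => y.
change ((f y - f x) / (y - x) + (g y - g x) / (y - x) =
  (f y + g y - (f x + g x)) / (y - x)).
by ring.
Qed.

Lemma is_deriv01M f g x l m : is_deriv01 f x l -> is_deriv01 g x m ->
  is_deriv01 (fun y => f y * g y) x (l * g x + f x * m).
Proof.
move=> + gm; rewrite is_deriv01E => fl; have gx := is_deriv01_cvg gm.
rewrite !is_deriv01E in gm *.
apply: cvg_trans (cvgD (cvgM fl gx) (cvgM (cvg_cst (f x)) gm));
  apply: near_eq_cvg.
apply: nearW => y.
change ((f y - f x) / (y - x) * g y + f x * ((g y - g x) / (y - x)) =
  (f y * g y - f x * g x) / (y - x)).
by ring.
Qed.

(** Dividing by the factorial makes each derivative exactly minus the preceding power, the source of
    the cancellation in Taylor's formula. *)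
Lemma is_deriv01_exp c n x : is_deriv01 (fun y => (c - y) ^+ n.+1 / n.+1`!%:R) x
  (- ((c - x) ^+ n / n`!%:R)).
Proof.
elim: n => [|n IH].
  rewrite expr0 fact0 divr1.
  have -> : (fun y => (c - y) ^+ 1 / 1`!%:R) = (fun y => c - y)
    by apply/funext => y; rewrite expr1 divr1.
  exact: is_deriv01_subl.
have -> : (fun y => (c - y) ^+ n.+2 / n.+2`!%:R) =
   (fun y => ((c - y) ^+ n.+1 / n.+1`!%:R) * (((c - y) * n.+2%:R^-1))).
  apply/funext => y; rewrite exprSr factS natrM invfM; ring.
have := is_deriv01M IH (is_deriv01M (is_deriv01_subl c x) (is_deriv01_cst
  n.+2%:R^-1 x)).
rewrite (_ : - (_ / _) * _ + _ = - ((c - x) ^+ n.+1 / n.+1`!%:R))//.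
rewrite exprSr factS natrM.
have : (n`!%:R : R) != 0 by rewrite pnatr_eq0 -lt0n fact_gt0.
have : (n.+1%:R : R) != 0 by rewrite pnatr_eq0.
have : (n.+2%:R : R) != 0 by rewrite pnatr_eq0.
have -> : n.+2%:R = n.+1%:R + 1 :> R by rewrite -natr1.
move=> ? ? ?; field.
by apply/and3P; split.
Qed.

(** A mean value inequality by Cousin induction: near each [c] the increments from [c] are at most
    (|f'(c)| + 1) times the distance, the 1 being the tolerance in the derivative. The loss from [M]
    to [M + 1] is harmless, since only absolute continuity is drawn from it. *)
Lemma is_deriv01_lipschitz f (f' : R -> R) M :
  (forall x, 0 <= x <= 1 -> is_deriv01 f x (f' x)) ->
  (forall x, 0 <= x <= 1 -> `|f' x| <= M) ->
  forall x y, 0 <= x -> x <= y -> y <= 1 -> `|f y - f x| <= (M + 1) * (y - x).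
Proof.
move=> df f'M x y x0 xy y1.
apply: (@cousin_ind _ (fun y => `|f y - f x| <= (M + 1) * (y - x)) x y) => //.
  by rewrite !subrr normr0 mulr0.
move=> c /andP[xc cy].
have c01 : 0 <= c <= 1 by rewrite (le_trans x0 xc) (le_trans cy y1).
have /is_deriv01P/(_ _ ltr01)[e e0 He] := df c c01.
exists e => // u v xu uc cv vy vue Pu.
have Lip w : 0 <= w <= 1 -> `|w - c| < e -> `|f w - f c| <= (M + 1) * `|w - c|.
  move=> w01 wc; have := He w w01 wc.
  have := f'M c c01; rewrite mul1r => Mc.
  have := ler_normD (f w - f c - f' c * (w - c)) (f' c * (w - c)).
  rewrite subrK normrM => /le_trans h1 h2; apply: h1.
  by rewrite mulrDl mul1r addrC lerD// ler_wpM2r.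
have u01 : 0 <= u <= 1 by apply/andP; split; lra.
have v01 : 0 <= v <= 1 by apply/andP; split; lra.
have ucE : `|u - c| = c - u by rewrite distrC ger0_norm// subr_ge0.
have vcE : `|v - c| = v - c by rewrite ger0_norm// subr_ge0.
have := Lip u u01; rewrite ucE distrC => /(_ ltac:(lra)) Lu.
have := Lip v v01; rewrite vcE => /(_ ltac:(lra)) Lv.
have -> : f v - f x = (f v - f c) + (f c - f u) + (f u - f x) by ring.
apply: (le_trans (ler_normD _ _)).
have := ler_normD (f v - f c) (f c - f u).
have : (M + 1) * (v - x) = (M + 1) * (v - c) + (M + 1) * (c - u) + (M + 1) *
  (u - x) by ring.
lra.
Qed.

End derivatives.

Section absolute_continuity.
Variable R : realType.
Implicit Types (f g : R -> R) (x l : R).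

Lemma ac_unif f : abs_continuous01 f -> forall e, 0 < e ->
  exists2 dl : R, 0 < dl & forall x y, 0 <= x <= 1 -> 0 <= y <= 1 ->
    `|x - y| < dl -> `|f x - f y| < e.
Proof.
move=> acf e /acf[d d0 H]; exists d => //.
suff wlg x y : 0 <= x <= 1 -> 0 <= y <= 1 -> x <= y -> `|x - y| < d ->
  `|f x - f y| < e.
  move=> x y x01 y01; have [xy|/ltW yx] := leP x y; first exact: wlg.
  by rewrite distrC (distrC (f x)); exact: wlg.
move=> /andP[x0 x1] /andP[y0 y1] xy xyd.
have := H 1%N (fun=> x) (fun=> y); rewrite !big_ord1 distrC; apply => //.
  by move=> i j _ _ _; rewrite !ord1.
by move: xyd; rewrite distrC ger0_norm// subr_ge0.
Qed.

Lemma lipschitz_ac f M :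
  (forall x y, 0 <= x -> x <= y -> y <= 1 -> `|f y - f x| <= M * (y - x)) ->
  abs_continuous01 f.
Proof.
move=> fM e e0.
(* No sign of [M] is assumed, and a positive constant is needed to divide by. *)
have M1 : 0 < `|M| + 1 by rewrite ltr_wpDl.
exists (e / (`|M| + 1)); first by rewrite divr_gt0.
move=> n u v uv _ sumd.
apply: (@le_lt_trans _ _ (\sum_(i < n) (`|M| + 1) * (v i - u i))).
  apply: ler_sum => i _; have [u0 [uvi v1]] := uv i.
  apply: (le_trans (fM _ _ u0 uvi v1)); rewrite ler_wpM2r// ?subr_ge0//.
  by rewrite (le_trans (ler_norm _))// lerDl.
by rewrite -mulr_sumr mulrC -ltr_pdivlMr.
Qed.

(** Boundedness on [0,y] propagates in [y]: the modulus of uniform continuity for tolerance 1 serves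
    as a constant gauge. *)
Lemma ac_bounded f : abs_continuous01 f ->
  exists2 M, 0 < M & forall x, 0 <= x <= 1 -> `|f x| <= M.
Proof.
move=> /ac_unif/(_ _ ltr01)[d d0 Hd].
pose P y := exists2 M, 0 < M & forall x, 0 <= x <= y -> `|f x| <= M.
suff : P 1 by [].
apply: (@cousin_ind _ P 0 1) => //.
  exists (`|f 0| + 1); first by rewrite ltr_wpDl.
  by move=> x; rewrite -eq_le => /eqP<-; rewrite lerDl.
move=> c /andP[c0 c1]; exists d => // y z y0 yc cz z1 zyd [M M0 HM].
exists (Num.max M (`|f c| + 1)); first by rewrite lt_max M0.
move=> x /andP[x0 xz]; rewrite le_max.
have [xy|yx] := leP x y; first by rewrite HM// x0.
apply/orP; right.
have := ler_normD (f c) (f x - f c); rewrite [f c + _]addrC subrK => /le_trans;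
  apply.
rewrite lerD2l ltW//; apply: Hd; [by apply/andP; split; lra | by apply/andP;
  split; lra|].
by rewrite ltr_norml; apply/andP; split; lra.
Qed.

Lemma acD f g : abs_continuous01 f -> abs_continuous01 g ->
  abs_continuous01 (fun x => f x + g x).
Proof.
move=> acf acg e e0.
have e20 : 0 < e / 2 by rewrite divr_gt0.
have [d1 d10 H1] := acf _ e20; have [d2 d20 H2] := acg _ e20.
exists (Num.min d1 d2); first by rewrite lt_min d10.
move=> n u v uv tI; rewrite lt_min => /andP[s1 s2].
have h1 := H1 n u v uv tI s1; have h2 := H2 n u v uv tI s2.
apply: (@le_lt_trans _ _ (\sum_(i < n) `|f (v i) - f (u i)| +
  \sum_(i < n) `|g (v i) - g (u i)|)).
  rewrite -big_split/=; apply: ler_sum => i _.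
  by rewrite (_ : _ - _ = (f (v i) - f (u i)) +
    (g (v i) - g (u i))) ?ler_normD//; ring.
lra.
Qed.

Lemma acM f g : abs_continuous01 f -> abs_continuous01 g ->
  abs_continuous01 (fun x => f x * g x).
Proof.
move=> acf acg e e0.
have [M M0 HM] := ac_bounded acf; have [N N0 HN] := ac_bounded acg.
have e1 : 0 < e / (2 * N) by rewrite divr_gt0 ?mulr_gt0.
have e2 : 0 < e / (2 * M) by rewrite divr_gt0 ?mulr_gt0.
have [d1 d10 H1] := acf _ e1; have [d2 d20 H2] := acg _ e2.
exists (Num.min d1 d2); first by rewrite lt_min d10.
move=> n u v uv tI; rewrite lt_min => /andP[s1 s2].
have h1 := H1 n u v uv tI s1; have h2 := H2 n u v uv tI s2.
apply: (@le_lt_trans _ _ (N * (\sum_(i < n) `|f (v i) - f (u i)|) +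
    M * (\sum_(i < n) `|g (v i) - g (u i)|))).
  rewrite !mulr_sumr -big_split/=; apply: ler_sum => i _.
  have [u0 [uvi v1]] := uv i.
  rewrite (_ : _ - _ = g (v i) * (f (v i) - f (u i)) + f (u i) *
    (g (v i) - g (u i))); last by ring.
  rewrite (le_trans (ler_normD _ _))// !normrM lerD// ler_wpM2r// ?HM ?HN//;
    apply/andP; split; lra.
have : N * (e / (2 * N)) + M * (e / (2 * M)) = e.
  by field; apply/andP; split; rewrite gt_eqF.
rewrite -(ltr_pM2l N0) in h1; rewrite -(ltr_pM2l M0) in h2.
lra.
Qed.

Lemma ac_cst c : abs_continuous01 (fun=> c : R).
Proof. by apply: (@lipschitz_ac _ 0) => x y; rewrite subrr normr0 mul0r. Qed.

Lemma ac_exp c n (k : R) : abs_continuous01 (fun x => (c - x) ^+ n / k).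
Proof.
apply: acM; last exact: ac_cst.
elim: n => [|n IH]; first exact: ac_cst.
rewrite (_ : (fun x => _) = (fun x => (c - x) * (c - x) ^+ n)); last first.
  by apply/funext => x; rewrite exprS.
apply: acM => //.
apply: (@lipschitz_ac _ 1) => x y _ xy _; rewrite mul1r.
have -> : c - y - (c - x) = - (y - x) by ring.
by rewrite normrN ger0_norm// subr_ge0.
Qed.

Lemma deriv_ac f (f' : R -> R) : (forall x, 0 <= x <= 1 ->
  is_deriv01 f x (f' x)) ->
  abs_continuous01 f' -> abs_continuous01 f.
Proof.
move=> df /ac_bounded[M _ HM].
exact: lipschitz_ac (is_deriv01_lipschitz df HM).
Qed.

End absolute_continuity.

(** * The fundamental theorem of calculus for absolutely continuous functions *)

Section integrable_bounded.
Context d (T : measurableType d) (R : realType) (mu : {finite_measure set T ->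
  \bar R}).
Implicit Types (f g h : T -> R).

Lemma integrable_bounded f M : measurable_fun setT f ->
  (forall x, `|f x| <= M) ->
  mu.-integrable setT (EFin \o f).
Proof.
move=> mf fM; apply: measurable_bounded_integrable => //.
  by rewrite -ge0_fin_numE// fin_num_measure.
exists M; split; first exact: num_real.
by move=> N MN x _ /=; rewrite (le_trans (fM x))// ltW.
Qed.

Lemma integrable_mulb f h M : mu.-integrable setT (EFin \o f) ->
  measurable_fun setT h -> (forall x, `|h x| <= M) ->
  mu.-integrable setT (EFin \o (fun x => f x * h x)).
Proof.
move=> intf mh hM.
have := @integrableMl _ _ _ mu setT measurableT (EFin \o f) h intf mh.
apply; exists M; split; first exact: num_real.
by move=> N MN x _ /=; rewrite (le_trans (hM x))// ltW.
Qed.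

Lemma integrable_norm f : mu.-integrable setT (EFin \o f) ->
  mu.-integrable setT (EFin \o (fun x => `|f x|)).
Proof. by move=> /integrable_abse. Qed.

Lemma le_normr_Rintegral_bound f h : mu.-integrable setT (EFin \o f) ->
  mu.-integrable setT (EFin \o h) -> (forall x, `|f x| <= h x) ->
  `|\int[mu]_x f x| <= \int[mu]_x h x.
Proof.
move=> intf inth fh; apply: (le_trans (le_normr_Rintegral measurableT intf)).
by apply: le_Rintegral => //; exact: integrable_norm.
Qed.

End integrable_bounded.

Section leb01_basics.
Variable R : realType.
Notation I01 := (`[0, 1]%classic : set (measurableTypeR R)).
Notation mu := (@lebesgue_measure R).
Implicit Types (v : R -> R) (x y : R).

Let mI01 : measurable I01. Proof. exact: measurable_itv. Qed.

Lemma leb01_out : leb01 R (~` I01) = 0%E.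
Proof. by rewrite /leb01/= /mrestr setICl measure0. Qed.

Lemma leb01_itvco x y : 0 <= x -> x <= y -> y <= 1 ->
  leb01 R `[x, y[ = (y - x)%:E.
Proof.
move=> x0 xy y1; rewrite /leb01/= /mrestr setIidl.
  rewrite lebesgue_measure_itv/= lte_fin; case: ltP => yx; first
    by rewrite -EFinB.
  have xyE : x = y by lra.
  by rewrite xyE subrr.
by move=> z /=; rewrite !in_itv/= => /andP[? ?]; apply/andP; split; lra.
Qed.

Lemma leb01_aeP (P : R -> Prop) : (\forall x \ae leb01 R, P x) <->
  mu.-negligible (I01 `&` ~` [set x | P x]).
Proof.
split=> [[A [mA A0 PA]]|[A [mA A0 PA]]].
  exists (A `&` I01); split => //; first exact: measurableI.
  by move=> x [x01 nPx]; split => //; exact: PA.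
exists (A `|` ~` I01); split.
- by apply: measurableU => //; exact: measurableC.
- rewrite /leb01/= /mrestr setIUl setICl setU0.
  by apply: subset_measure0 A0 => //; exact: measurableI.
- by move=> x nPx; have [x01|] := pselect (I01 x); [left; exact: PA|right].
Qed.

Lemma leb01_aeW (P : R -> Prop) : (\forall x \ae mu, P x) ->
  \forall x \ae leb01 R, P x.
Proof. by move=> H; apply/leb01_aeP; apply: negligibleS H => x []. Qed.

Lemma ge0_integral_leb01 (f : R -> \bar R) : measurable_fun setT f ->
  (forall x, (0 <= f x)%E) -> (\int[leb01 R]_x f x = \int[mu]_(x in I01) f x)%E.
Proof.
move=> mf f0.
rewrite (@ge0_negligible_integral _ _ _ _ setT (~` I01))//; last 2 first.
- exact: measurableC.
- exact: leb01_out.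
rewrite setTD setCK; apply: (@eq_measure_integral _ _ _ _ mu) => A mA A01.
by transitivity (mu (A `&` I01)) => //; congr (mu _); exact: setIidl.
Qed.

Lemma integral_leb01 v : (leb01 R).-integrable setT (EFin \o v) ->
  \int[leb01 R]_x v x = \int[mu]_(x in I01) v x.
Proof.
move=> iv; congr fine.
rewrite (@negligible_integral _ _ _ _ setT (~` I01))//; last 2 first.
- exact: measurableC.
- exact: leb01_out.
rewrite setTD setCK; apply: (@eq_measure_integral _ _ _ _ mu) => A mA A01.
by transitivity (mu (A `&` I01)) => //; congr (mu _); exact: setIidl.
Qed.

Lemma leb01_integrable v : (leb01 R).-integrable setT (EFin \o v) ->
  mu.-integrable I01 (EFin \o v).
Proof.
move=> /integrableP[mv iv]; apply/integrableP; split.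
  exact: measurable_funTS.
by rewrite -ge0_integral_leb01//; exact: measurableT_comp.
Qed.

(* With this weight an integral becomes the oriented one from [y] to [x]. *)
Definition oriented x y t : R := (t < x)%R%:R - (t < y)%R%:R.

Lemma measurable_lt x : measurable_fun setT (fun t : measurableTypeR R =>
  (t < x)%R%:R : R).
Proof.
rewrite (_ : (fun t => _) = \1_(`]-oo, x[%classic : set R)); last first.
  by apply/funext => t; rewrite indicE mem_setE in_itv.
by apply: measurable_indic; exact: measurable_itv.
Qed.

Lemma measurable_oriented x y : measurable_fun setT (oriented x y :
  measurableTypeR R -> R).
Proof. by apply: measurable_funB; exact: measurable_lt. Qed.

Lemma oriented_le1 x y t : `|oriented x y t| <= 1.
Proof.
rewrite /oriented; do 2 case: ltP => _ //=;
  rewrite ?subrr ?subr0 ?sub0r ?normrN ?normr1 ?normr0//.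
Qed.

Lemma orientedxx x t : oriented x x t = 0. Proof.
  by rewrite /oriented subrr. Qed.

Lemma oriented_itvco x y t : x <= y -> oriented y x t = \1_`[x, y[%classic t.
Proof.
move=> xy; rewrite /oriented indicE mem_setE in_itv/=.
case: ltP => ty; case: ltP => tx //=; rewrite ?subrr ?subr0//.
by exfalso; lra.
Qed.

Lemma integral_oriented x y : 0 <= x -> x <= y -> y <= 1 ->
  \int[leb01 R]_t oriented y x t = y - x.
Proof.
move=> x0 xy y1; under eq_Rintegral do rewrite oriented_itvco//.
by rewrite /Rintegral integral_indic//= ?setIT ?leb01_itvco//;
  exact: measurable_itv.
Qed.

Lemma integrable_oriented v x y : (leb01 R).-integrable setT (EFin \o v) ->
  (leb01 R).-integrable setT (EFin \o (fun t => v t * oriented x y t)).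
Proof.
by move=> iv; apply: (integrable_mulb iv (measurable_oriented x y)
  (oriented_le1 x y)).
Qed.

Definition primitive (a : R) v (x : R) : R :=
  \int[leb01 R]_t (v t * oriented x a t).

Lemma primitiveB a v x y : (leb01 R).-integrable setT (EFin \o v) ->
  primitive a v x - primitive a v y = \int[leb01 R]_t (v t * oriented x y t).
Proof.
move=> iv; rewrite /primitive -RintegralB//; try exact: integrable_oriented.
by congr Rintegral; apply/funext => t; rewrite /oriented; ring.
Qed.

Lemma primitive_id a v : primitive a v a = 0.
Proof.
by rewrite /primitive; under eq_Rintegral do rewrite orientedxx mulr0;
  rewrite Rintegral_cst// mul0r.
Qed.

(** The increments over the given intervals are dominated by the integral of |v| over their union,
    which is small as soon as the measure of the union is. *)
Lemma primitive_ac a v : (leb01 R).-integrable setT (EFin \o v) ->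
  abs_continuous01 (primitive a v).
Proof.
move=> iv e e0.
have [dl [dl0 Hdl]] := integral_normr_continuous iv e0.
exists dl => // n u w uw tI sumd.
pose F (i : 'I_n) : set (measurableTypeR R) := `[u i, w i[%classic.
have mF i : measurable (F i) by exact: measurable_itv.
have tF : trivIset [set` index_enum 'I_n] F.
  move=> i j _ _ [t []]; rewrite /F/= !in_itv/= => /andP[ui wi] /andP[uj wj].
  (* Disjointness is assumed for open intervals but used for half-open ones: moving from a common
     point towards the smaller right end yields a common interior point. *)
  apply: (tI i j) => //; exists ((t + Num.min (w i) (w j)) / 2) => /=.
  have h1 : t < Num.min (w i) (w j) by rewrite lt_min wi.
  have h2 : Num.min (w i) (w j) <= w i by rewrite ge_min lexx.
  have h3 : Num.min (w i) (w j) <= w j by rewrite ge_min lexx orbT.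
  by split; rewrite /= in_itv/=; apply/andP; split; lra.
pose A := \big[setU/set0]_(i <- index_enum 'I_n) F i.
have mA : measurable A by exact: bigsetU_measurable.
have lA : (leb01 R A < dl%:E)%E.
  have -> : leb01 R A = (\sum_(i < n) leb01 R (F i))%E.
    have c1 B : measurable B -> (\int[leb01 R]_(x in B) 1%:E = leb01 R B)%E.
      by move=> mB; rewrite (integral_cst _ _ 1%E)// mul1e.
    apply: etrans (esym (c1 _ mA)) _.
    rewrite (@integral_bigsetU_EFin _ _ _ _ _ _ (cst 1))//; last first.
    - by apply/measurable_EFinP; exact: measurable_cst.
    - exact: index_enum_uniq.
    by apply: eq_bigr => i _; exact: c1.
  under eq_bigr => i _.
    have [? [? ?]] := uw i.
    rewrite leb01_itvco//.
    over.
  by rewrite sumEFin lte_fin.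
apply: le_lt_trans (Hdl A mA lA).
have mv : measurable_fun setT (fun t : measurableTypeR R => `|v t|).
  by apply: measurableT_comp => //; apply/measurable_EFinP;
    exact: measurable_int iv.
rewrite /Rintegral integral_bigsetU_EFin//; last 2 first.
- exact: index_enum_uniq.
- by apply/measurable_EFinP; exact: measurable_funTS.
rewrite -sum_fine; last first.
  move=> i _; apply: integrable_fin_num => //.
  by apply: integrableS (integrable_norm iv).
apply: ler_sum => i _; have [? [? ?]] := uw i.
rewrite primitiveB//.
have ivs : (leb01 R).-integrable setT (EFin \o (fun t => `|v t| *
  oriented (w i) (u i) t)).
  by apply: integrable_oriented; exact: integrable_norm.
apply: le_trans (le_normr_Rintegral_bound (integrable_oriented _ _ iv) ivs _) _.
  move=> t; rewrite normrM ler_wpM2l//.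
  by rewrite oriented_itvco// ger0_norm.
rewrite -[leRHS]/(\int[leb01 R]_(x in F i) `|v x|) [leRHS]Rintegral_mkcond.
rewrite le_eqVlt; apply/orP; left; apply/eqP; congr Rintegral;
  apply/funext => t /=.
by rewrite oriented_itvco// patchE indicE; case: ifPn => _;
  rewrite ?mulr1 ?mulr0.
Qed.

End leb01_basics.

Section ftc.
Variable R : realType.
Notation I01 := (`[0, 1]%classic : set (measurableTypeR R)).
Notation mu := (@lebesgue_measure R).
Implicit Types (v f : R -> R) (x y : R).

Let icst c : (leb01 R).-integrable setT (EFin \o (fun=> c : R)).
Proof. exact: finite_measure_integrable_cst. Qed.

(** Continuity at [x] relative to [0,1] gives the derivative at [x] itself, not merely almost
    everywhere; this supplies the lower derivatives of iterated primitives. *)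
Lemma primitive_deriv a v x : (leb01 R).-integrable setT (EFin \o v) ->
  0 <= x <= 1 ->
  (forall e, 0 < e -> exists2 dl : R, 0 < dl &
    forall y, 0 <= y <= 1 -> `|y - x| < dl -> `|v y - v x| <= e) ->
  is_deriv01 (primitive a v) x (v x).
Proof.
move=> iv /andP[x0 x1] cv; apply/is_deriv01P => e /cv[dl dl0 Hdl];
  exists dl => //.
move=> y /andP[y0 y1] yx.
have iS (u w : R) : (leb01 R).-integrable setT (EFin \o (fun t =>
  oriented u w t)).
  exact: (integrable_bounded _ (measurable_oriented u w) (oriented_le1 u w)).
have [xl xr yl yr] : [/\ Num.min x y <= x, Num.min x y <= y, x <=
  Num.max x y & y <= Num.max x y].
  by split; rewrite ?ge_min ?le_max lexx ?orbT.
have lr : Num.min x y <= Num.max x y by apply: le_trans xl _.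
have l0 : 0 <= Num.min x y by rewrite le_min x0.
have r1 : Num.max x y <= 1 by rewrite ge_max x1.
have lrE : Num.max x y - Num.min x y = `|y - x|.
  rewrite minEle maxEle; case: ifPn => [xy|]; first
    by rewrite ger0_norm ?subr_ge0.
  by rewrite -ltNge => yx'; rewrite ltr0_norm ?subr_lt0// opprB.
have absS t : `|oriented y x t| = oriented (Num.max x y) (Num.min x y) t.
  rewrite minEle maxEle /oriented; case: ifPn => [xy|].
    by case: ltP => ty; case: ltP => tx /=;
      rewrite ?subrr ?subr0 ?normr0 ?normr1//; lra.
  rewrite -ltNge => xy.
  by case: ltP => ty; case: ltP => tx /=;
    rewrite ?subrr ?subr0 ?sub0r ?normrN ?normr0 ?normr1//; lra.
have intS : \int[leb01 R]_t oriented y x t = y - x.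
  have [xy|/ltW yx'] := leP x y; first by rewrite integral_oriented.
  have := integral_oriented y0 yx' x1.
  rewrite -(opprB y x) => /(congr1 -%R); rewrite opprK => <-.
  rewrite -mulN1r -RintegralZl//; congr Rintegral; apply/funext => t.
  by rewrite /oriented; ring.
rewrite -lrE primitiveB// -intS -RintegralZl// -RintegralB//; last 2 first.
- exact: integrable_oriented.
- by have := integrable_oriented y x (icst (v x)).
rewrite -(integral_oriented l0 lr r1) -RintegralZl//.
have mI01 : measurable I01 by exact: measurable_itv.
(* The bound on |v t - v x| is available only for [t] in [0,1], so both integrands are cut off there
   before being compared pointwise. *)
have h (w : R -> R) : (leb01 R).-integrable setT (EFin \o w) ->
    \int[leb01 R]_t w t = \int[leb01 R]_t (w \_ I01) t.
  move=> iw; rewrite -Rintegral_mkcond; congr fine.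
  rewrite (@negligible_integral _ _ _ _ setT (~` I01))//; last 2 first.
  - exact: measurableC.
  - exact: leb01_out.
  by rewrite setTD setCK.
have i1 : (leb01 R).-integrable setT (EFin \o (fun t => v t *
  oriented y x t - v x * oriented y x t)).
  apply: (integrableB _ (integrable_oriented y x iv) (integrable_oriented y x
    (icst (v x)))) => //.
have i2 : (leb01 R).-integrable setT (EFin \o (fun t => e *
  oriented (Num.max x y) (Num.min x y) t)).
  by have := integrable_oriented (Num.max x y) (Num.min x y) (icst e).
have ir (w : R -> R) : (leb01 R).-integrable setT (EFin \o w) ->
    (leb01 R).-integrable setT (EFin \o (w \_ I01)).
  move=> iw; rewrite -restrict_EFin; apply/integrable_restrict => //.
  by apply: integrableS iw; rewrite ?setTI.
rewrite h// [leRHS]h//; apply: le_normr_Rintegral_bound; try exact: ir.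
move=> t; rewrite !patchE; case: ifPn => [|_]; last by rewrite normr0.
rewrite inE/= in_itv/= => t01.
rewrite -mulrBl normrM absS.
have [tlr|tlr] := boolP (t \in `[Num.min x y, Num.max x y[); last first.
  by rewrite oriented_itvco// indicE mem_setE (negbTE tlr) !mulr0.
rewrite ler_wpM2r//; first by rewrite -absS.
apply: Hdl => //; apply: le_lt_trans yx.
rewrite -lrE; move: tlr; rewrite in_itv/= => /andP[? ?].
by rewrite ler_norml; apply/andP; split; lra.
Qed.

(** Lebesgue differentiation on the line, applied to [v] extended by zero: its primitive [F] from
    minus infinity differs from [primitive a v] by a constant, and a two-sided derivative is also
    one relative to [0,1]. *)
Lemma primitive_ae_deriv a v : (leb01 R).-integrable setT (EFin \o v) ->
  \forall x \ae leb01 R, is_deriv01 (primitive a v) x (v x).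
Proof.
move=> iv.
have mI01 : measurable I01 by exact: measurable_itv.
have iv' : mu.-integrable setT (EFin \o (v \_ I01)).
  rewrite -restrict_EFin; apply/integrable_restrict => //.
  by rewrite setTI; exact: leb01_integrable.
have lv' : locally_integrable setT (v \_ I01).
  by apply: open_integrable_locally => //; exact: openT.
have iy (y : R) : mu.-integrable `]-oo, y] (EFin \o (v \_ I01)).
  by apply: integrableS iv'.
pose F (y : R) : R := \int[mu]_(t in `]-oo, y]) (v \_ I01) t.
have aeP : \forall x \ae leb01 R, derivable F x 1 /\ F^`()%classic x =
  (v \_ I01) x.
  exact: leb01_aeW (FTC1Ny iy lv').
have ae01 : \forall x \ae leb01 R, I01 x.
  by exists (~` I01); split => //; [exact: measurableC|exact: leb01_out].
apply: (@filterS2 _ _ (ae_filter_ringOfSetsType (leb01 R)) _ _ _ _ ae01 aeP).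
move=> x x01 [dF F'x].
have FE y : primitive a v y = F y + primitive a v 0.
  apply/eqP; rewrite -subr_eq primitiveB// integral_leb01;
    last exact: integrable_oriented.
  rewrite /F -Rintegral_itv_bndo_bndc; last by apply: integrableS iv'.
  rewrite Rintegral_mkcond [in X in _ == X]Rintegral_mkcond; apply/eqP.
  congr Rintegral; apply/funext => t; rewrite !patchE !mem_setE !in_itv/=.
  case: ifPn => [/andP[t0 t1]|_]; last by rewrite if_same.
  rewrite /oriented (ltNge t 0) t0 subr0; case: ifPn => _;
    by rewrite ?mulr1 ?mulr0.
have dF' : h^-1 *: (F (h + x) - F x) @[h --> 0^'] --> (v \_ I01) x.
  rewrite -F'x; move: dF; rewrite /derivable /derive1.
  under eq_fun do rewrite /= scaler1.
  by [].
rewrite patchE mem_set// in dF'.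
apply/is_deriv01P => e e0.
move/cvgrPdist_le : dF' => /(_ e e0);
  rewrite near_withinE => /nbhs_ballP[dl dl0 Hdl].
exists dl => // y y01 yx; have [->|yx0] := eqVneq y x.
  by rewrite !subrr mulr0 subr0 normr0 mulr0.
rewrite (FE y) (FE x); have yx0' : y - x != 0 by rewrite subr_eq0.
have := Hdl (y - x); rewrite /ball/= sub0r normrN => /(_ yx yx0').
rewrite subrK => H; rewrite -(ler_pM2r (x :=
  `|y - x|)) ?normr_gt0// -normrM in H.
apply: le_trans H; rewrite le_eqVlt -normrN; apply/orP; left; apply/eqP;
  congr (`|_|).
rewrite /GRing.scale/=; by field.
Qed.

(* Off the null set of bad points the increments are at most [e] times the length;
   the bad points are covered by an open set of small measure. *)
Lemma ac_deriv0_const f : abs_continuous01 f ->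
  (\forall x \ae leb01 R, is_deriv01 f x 0) ->
  forall x, 0 <= x <= 1 -> f x = f 0.
Proof.
move=> acf /leb01_aeP[N [mN N0 subN]] x /andP[x0 x1].
have [//|ne] := eqVneq (f x) (f 0); exfalso.
have : 0 < `|f x - f 0| by rewrite normr_gt0 subr_eq0.
set e := `|f x - f 0| => e0.
have e20 : 0 < e / 2 by rewrite divr_gt0.
have [dl dl0 Hdl] := acf _ e20.
have [|U [oU NU mUN]] := lebesgue_regularity_outer mN _ dl0.
  by rewrite [X in (X < _)%E](_ : _ = 0%E) ?ltry.
have mU : measurable U by exact: open_measurable.
have mUdl : (mu U < dl%:E)%E.
  have -> : U = N `|` (U `\` N) by rewrite setDUK.
  apply: le_lt_trans (measureU2 _ _ _) _ => //; first exact: measurableD.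
  by rewrite [X in (X + _)%E](_ : _ = 0%E) ?add0e.
pose W y : set (measurableTypeR R) := U `&` `[0, y[%classic.
have mW y : measurable (W y) by apply: measurableI => //; exact: measurable_itv.
(* The invariant splits the increment of [f] up to [y] into a part of slope at most [e / 2] and
   increments over disjoint intervals whose total length is paid for by the measure of [U] to the
   left of [y]. At the end each part is at most [e / 2], the second strictly less by absolute
   continuity. *)
pose P y := exists n (u w : 'I_n -> R),
  [/\ forall i, 0 <= u i /\ u i <= w i /\ w i <= y,
      trivIset setT (fun i => `]u i, w i[%classic),
      ((\sum_(i < n) (w i - u i))%:E <= mu (W y))%E &
      `|f y - f 0| <= e / 2 * y + \sum_(i < n) `|f (w i) - f (u i)|].
suff : P x.
  move=> [n [u [w [uw tI sl fx]]]].
  have sd : \sum_(i < n) (w i - u i) < dl.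
    rewrite -lte_fin; apply: (le_lt_trans sl); apply: le_lt_trans mUdl.
    by apply: le_measure; rewrite ?inE//; apply: subIsetl.
  have uw1 i : 0 <= u i /\ u i <= w i /\ w i <= 1.
    by have [? [? ?]] := uw i; split => //; split => //; lra.
  have := Hdl n u w uw1 tI sd; rewrite -/e in fx.
  have : e / 2 * x <= e / 2 by rewrite ler_piMr// ltW.
  lra.
apply: (@cousin_ind _ P 0 x x0).
  exists 0%N, (fun=> 0), (fun=> 0); split.
  - by case.
  - by case.
  - by rewrite big_ord0.
  - by rewrite big_ord0 subrr normr0 mulr0 addr0.
move=> c /andP[c0 cx].
have c01 : 0 <= c <= 1 by rewrite c0 (le_trans cx).
have [dc|ndc] := pselect (is_deriv01 f c 0).
  move/is_deriv01P : dc => /(_ _ e20)[d d0 Hd]; exists d => //.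
  move=> y z y0 yc cz zx zyd [n [u [w [uw tI sl fy]]]].
  exists n, u, w; split => //.
  - by move=> i; have [? [? ?]] := uw i; split => //; split => //; lra.
  - apply: (le_trans sl); apply: le_measure; rewrite ?inE//.
    apply: setIS => t /=; rewrite !in_itv/= => /andP[-> ty]; lra.
  - have z1 : `|f z - f c| <= e / 2 * (z - c).
      by have := Hd z; rewrite mul0r subr0 ger0_norm ?subr_ge0//; apply;
        [apply/andP; split|]; lra.
    have y1 : `|f y - f c| <= e / 2 * (c - y).
      have := Hd y; rewrite mul0r subr0 (distrC y) ger0_norm ?subr_ge0//.
      by apply; [apply/andP; split|]; lra.
    rewrite (_ : f z - f 0 = (f z - f c) + (f c - f y) + (f y - f 0)); last
      by ring.
    apply: (le_trans (ler_normD _ _));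
      have := ler_normD (f z - f c) (f c - f y).
    rewrite (distrC (f c)).
    have -> : e / 2 * z = e / 2 * (z - c) + e / 2 * (c - y) + e / 2 * y by ring.
    lra.
(* Around a bad point the gauge keeps [y,z[ inside the open set [U]. The interval is appended as the
   last entry of the families, and the measure of [W] grows by its full length. *)
have Uc : U c by apply: NU; apply: subN.
have /nbhs_ballP[d d0 dU] : nbhs c U by exact: open_nbhs_nbhs.
exists d => // y z y0 yc cz zx zyd [n [u [w [uw tI sl fy]]]].
exists n.+1, (fun i => if unlift ord_max i is Some j then u j else y),
  (fun i => if unlift ord_max i is Some j then w j else z).
have SE (F : R -> R -> R) (y' z' : R) :
   \sum_(i < n.+1) F (if unlift ord_max i is Some j then w j else z')
      (if unlift ord_max i is Some j then u j else y') =
   \sum_(i < n) F (w i) (u i) + F z' y'.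
  rewrite big_ord_recr/= unlift_none; congr (_ + _); apply: eq_bigr => i _.
  have -> : widen_ord (leqnSn n) i = lift ord_max i.
    by apply: val_inj => /=; rewrite /bump leqNgt ltn_ord.
  by rewrite liftK.
split.
- move=> i; case: unliftP => [j _|_]; last by split => //; split => //; lra.
  by have [? [? ?]] := uw j; split => //; split => //; lra.
- move=> i j _ _; case: unliftP => [i' ->|->]; case: unliftP => [j' ->|->].
  + by move=> /(tI i' j' I I) ->.
  + move=> [t [/=]]; rewrite !in_itv/= => /andP[? ?] /andP[? ?].
    by have [? [? ?]] := uw i'; (suff : t < t by rewrite ltxx); lra.
  + move=> [t [/=]]; rewrite !in_itv/= => /andP[? ?] /andP[? ?].
    by have [? [? ?]] := uw j'; (suff : t < t by rewrite ltxx); lra.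
  + by [].
- rewrite (SE (fun a b => a - b)) //.
  have yzU : `[y, z[%classic `<=` U.
    move=> t; rewrite /= in_itv/= => /andP[yt tz]; apply: dU.
    by rewrite /ball/= ltr_norml; apply/andP; split; lra.
  have myz : measurable (`[y, z[%classic : set (measurableTypeR R))
    by exact: measurable_itv.
  have -> : W z = W y `|` `[y, z[%classic.
    apply/seteqP; split=> t; rewrite /W/= !in_itv/=.
      move=> [Ut /andP[t0 tz]]; have [yt|ty] := leP y t; last by left;
        rewrite t0.
      by right; rewrite tz.
    move=> [[Ut /andP[-> ty]]|/andP[yt tz]].
      by split => //; lra.
    split; last by apply/andP; split => //; lra.
    by apply: yzU; rewrite /= in_itv/= yt.
  rewrite measureU//; last first.
    apply/seteqP; split=> // t; rewrite /W/= !in_itv/= =>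
      -[[_ /andP[_ ty]] /andP[yt _]].
    by move: (lt_le_trans ty yt); rewrite ltxx.
  have lyz : mu `[y, z[%classic = (z - y)%:E.
    rewrite lebesgue_measure_itv/= lte_fin; case: ltP => zy; first
      by rewrite -EFinB.
    have zyE : z = y by apply/eqP; rewrite eq_le zy (le_trans yc cz).
    by rewrite zyE subrr.
  rewrite EFinD; apply: leeD => //.
  by rewrite [X in (_ <= X)%E](_ : _ = (z - y)%:E).
- rewrite (SE (fun a b => `|f a - f b|))//.
  rewrite (_ : f z - f 0 = (f z - f y) + (f y - f 0)); last by ring.
  apply: (le_trans (ler_normD _ _)).
  have : e / 2 * y <= e / 2 * z by rewrite ler_wpM2l//; lra.
  lra.
Qed.

(** The difference of [f] and the primitive of [v] is absolutely continuous with derivative 0 almost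
    everywhere, hence constant. *)
Theorem ac_ftc a f v x : abs_continuous01 f ->
  (leb01 R).-integrable setT (EFin \o v) ->
  (\forall x \ae leb01 R, is_deriv01 f x (v x)) -> 0 <= a <= 1 -> 0 <= x <= 1 ->
  f x - f a = primitive a v x.
Proof.
move=> acf iv df a01 x01.
pose h y := f y + -1 * primitive a v y.
have ach : abs_continuous01 h.
  by apply: acD => //; apply: acM; [exact: ac_cst|exact: primitive_ac].
have dh : \forall x \ae leb01 R, is_deriv01 h x 0.
  apply: (@filterS2 _ _ (ae_filter_ringOfSetsType (leb01 R)) _ _ _ _ df
    (primitive_ae_deriv a iv)).
  move=> y dfy dpy.
  have := is_deriv01D dfy (is_deriv01M (is_deriv01_cst (-1) y) dpy).
  by rewrite mul0r add0r mulN1r subrr.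
have := ac_deriv0_const ach dh x01;
  rewrite -(ac_deriv0_const ach dh a01) /h primitive_id.
lra.
Qed.
End ftc.

(** * Taylor's formula and the univariate Sobolev space *)

Section taylor.
Variable R : realType.
Notation I01 := (`[0, 1]%classic : set (measurableTypeR R)).
Notation mu := (@lebesgue_measure R).
Implicit Types (v f g : R -> R) (x y t : R) (D : nat -> R -> R).

Let mI01 : measurable I01. Proof. exact: measurable_itv. Qed.

Lemma ac_measurable f : abs_continuous01 f -> measurable_fun setT (f \_ I01).
Proof.
move=> acf.
(* Retraction of the line onto [0,1]. It is 1-Lipschitz, so [f \o c] is continuous everywhere, and
   it agrees with [f] on [0,1]. *)
pose c t := Num.max 0 (Num.min t 1).
have c01 t : 0 <= c t <= 1 by rewrite /c le_max lexx /= ge_max ler01 ge_min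
  lexx orbT.
have cid t : 0 <= t <= 1 -> c t = t.
  by move=> /andP[t0 t1]; rewrite /c (min_idPl t1) (max_idPr t0).
have clip t s : `|c t - c s| <= `|t - s|.
  wlog st : t s / s <= t => [H|].
    by have [/H//|/ltW/H] := leP s t; rewrite distrC (distrC s).
  rewrite (@ger0_norm _ (t - s)) ?subr_ge0// ler_norml /c /Num.max /Num.min.
  case: (ltP t 1) => ?; case: (ltP s 1) => ?; repeat case: ltP => ?;
  by apply/andP; split; lra.
have -> : f \_ I01 = (f \o c) \_ I01.
  apply/funext => t; rewrite !patchE; case: ifPn => //;
    rewrite mem_setE in_itv/= => t01.
  by rewrite /= cid.
apply/(measurable_restrictT _ mI01); apply: measurable_funTS.
apply: continuous_measurable_fun => t.
apply/cvgrPdist_lt => e e0.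
have [d d0 Hd] := ac_unif acf e0.
near=> s; apply: Hd => //; apply: le_lt_trans (clip _ _) _.
near: s; apply/nbhs_ballP; exists d => //= s.
Unshelve. all: end_near. Qed.

Lemma ac_bounded_patch f : abs_continuous01 f ->
  exists M, forall x, `|(f \_ I01) x| <= M.
Proof.
move=> /ac_bounded[M M0 HM]; exists M => x; rewrite patchE; case: ifPn.
  by rewrite mem_setE in_itv/= => /HM.
by rewrite normr0 ltW.
Qed.

Lemma ac_integrable f : abs_continuous01 f ->
  (leb01 R).-integrable setT (EFin \o (f \_ I01)).
Proof.
move=> acf; have [M HM] := ac_bounded_patch acf.
exact: integrable_bounded (ac_measurable acf) HM.
Qed.

Lemma eq_is_deriv01 f g x l : (forall y, 0 <= y <= 1 -> f y = g y) ->
  0 <= x <= 1 ->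
  is_deriv01 f x l -> is_deriv01 g x l.
Proof.
move=> fg x01 /is_deriv01P H; apply/is_deriv01P => e /H[d d0 Hd];
  exists d => // y y01 yx.
by rewrite -!fg//; exact: Hd.
Qed.

Lemma eq_ac f g : (forall y, 0 <= y <= 1 -> f y = g y) ->
  abs_continuous01 f -> abs_continuous01 g.
Proof.
move=> fg acf e /acf[d d0 Hd]; exists d => // n u v uv tI s.
under eq_bigr => i _.
  have [? [? ?]] := uv i.
  rewrite -!fg; [over | apply/andP; split; lra | apply/andP; split; lra].
exact: Hd.
Qed.

Definition taylor D n x t := \sum_(j < n.+1) D j t * ((x - t) ^+ j / j`!%:R).

(** By the product rule each summand yields two terms, and the one from differentiating the power
    cancels a term of the preceding summand; only the top derivative remains. *)
Lemma taylor_deriv D n x t :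
  (forall j, (j <= n)%N -> is_deriv01 (D j) t (D j.+1 t)) ->
  is_deriv01 (taylor D n x) t (D n.+1 t * ((x - t) ^+ n / n`!%:R)).
Proof.
elim: n => [|n IH] H.
  have -> : taylor D 0 x = D 0%N.
    by apply/funext => s; rewrite /taylor big_ord1 expr0 fact0 divr1 mulr1.
  by rewrite expr0 fact0 divr1 mulr1; exact: H.
have -> : taylor D n.+1 x = fun s => taylor D n x s + D n.+1 s *
  ((x - s) ^+ n.+1 / n.+1`!%:R).
  by apply/funext => s; rewrite /taylor big_ord_recr.
have h1 := is_deriv01M (H n.+1 (leqnn _)) (@is_deriv01_exp _ x n t).
have h2 : forall j, (j <= n)%N -> is_deriv01 (D j) t (D j.+1 t).
  by move=> j jn; apply: H; rewrite (leq_trans jn).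
have := is_deriv01D (IH h2) h1.
by rewrite mulrN addrCA subrr addr0.
Qed.

(** Descent from the top: an absolutely continuous derivative is bounded, so the function below it
    is Lipschitz. *)
Lemma chain_ac D n :
  (forall j x, (j < n)%N -> 0 <= x <= 1 -> is_deriv01 (D j) x (D j.+1 x)) ->
  abs_continuous01 (D n) -> forall j, (j <= n)%N -> abs_continuous01 (D j).
Proof.
move=> dD acD j jn; rewrite -(subKn jn); elim: (n - j)%N => [|k IH]; first
  by rewrite subn0.
(* Natural subtraction is truncated: once [k] reaches [n] the index stays at 0. *)
have [nk|kn] := leqP n k.
  by have -> : (n - k.+1 = n - k)%N by lia.
apply: (deriv_ac (f' := D (n - k)%N)) => // x x01.
have -> : (n - k = (n - k.+1).+1)%N by lia.
by apply: dD => //; lia.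
Qed.

(* Cut off outside [0,1] so as to be bounded; the complement is [leb01]-null. *)
Definition taylor_kernel n (a x t : R) :=
  ((fun t : R => (x - t) ^+ n / n`!%:R) \_ I01) t * oriented x a t.

Lemma measurable_taylor_kernel n a x : measurable_fun setT (taylor_kernel n a x
  : measurableTypeR R -> R).
Proof.
by apply: measurable_funM; [exact: ac_measurable (ac_exp _ _ _)|exact:
  measurable_oriented].
Qed.

Lemma taylor_kernel_le1 n a x t : 0 <= x <= 1 -> `|taylor_kernel n a x t| <= 1.
Proof.
move=> /andP[x0 x1]; rewrite /taylor_kernel normrM -[leRHS]mulr1;
  apply: ler_pM => //; last exact: oriented_le1.
rewrite patchE; case: ifPn => [|_]; last by rewrite normr0.
rewrite mem_setE in_itv/= => /andP[t0 t1];
  rewrite normrM normfV normrX normr_nat.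
rewrite ler_pdivrMr ?ltr0n ?fact_gt0// mul1r (@le_trans _ _ 1)//.
  by apply: exprn_ile1 => //; rewrite ler_norml; apply/andP; split; lra.
by rewrite ler1n fact_gt0.
Qed.

(* The Taylor polynomial at [x], as a function of its centre, telescopes when
   differentiated. *)
Theorem taylor_integral D n a g x : 0 <= a <= 1 ->
  (forall j y, (j < n)%N -> 0 <= y <= 1 -> is_deriv01 (D j) y (D j.+1 y)) ->
  (forall j, (j <= n)%N -> D j a = 0) ->
  abs_continuous01 (D n) ->
  (\forall y \ae leb01 R, is_deriv01 (D n) y (g y)) ->
  (leb01 R).-integrable setT (EFin \o g) ->
  0 <= x <= 1 -> D 0%N x = \int[leb01 R]_t (g t * taylor_kernel n a x t).
Proof.
move=> a01 dD Da acDn dg ig x01.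
pose w := (fun t : R => (x - t) ^+ n / n`!%:R) \_ I01.
have acp := ac_exp x n (n`!%:R : R).
have [M HM] := ac_bounded_patch acp.
have iw : (leb01 R).-integrable setT (EFin \o (fun t => g t * w t)).
  exact: (integrable_mulb ig (ac_measurable acp) HM).
have acT : abs_continuous01 (taylor D n x).
  have : forall k, (k <= n)%N -> abs_continuous01 (taylor D k x).
    elim=> [|k IH] kn.
      apply: (@eq_ac (D 0%N)) => [y _|]; last exact: chain_ac dD acDn _ _.
      by rewrite /taylor big_ord1 expr0 fact0 divr1 mulr1.
    have -> : taylor D k.+1 x = fun s => taylor D k x s + D k.+1 s *
      ((x - s) ^+ k.+1 / k.+1`!%:R).
      by apply/funext => s; rewrite /taylor big_ord_recr.
    apply: acD; first by apply: IH; exact: ltnW.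
    apply: acM; last exact: ac_exp.
    exact: chain_ac dD acDn _ kn.
  exact.
have dT : \forall y \ae leb01 R, is_deriv01 (taylor D n x) y (g y * w y).
  have ae01 : \forall x \ae leb01 R, I01 x.
    by exists (~` I01); split => //; [exact: measurableC|exact: leb01_out].
  apply: (@filterS2 _ _ (ae_filter_ringOfSetsType (leb01 R)) _ _ _ _ ae01 dg).
  move=> y y01 dgy; rewrite /w patchE mem_set//.
  pose D' j := if j == n.+1 then g else D j.
  have -> : taylor D n x = taylor D' n x.
    apply/funext => s; apply: eq_bigr => j _; rewrite /D'.
    by rewrite ifF//; apply/negbTE; rewrite neq_ltn ltn_ord.
  have D'n : D' n.+1 = g by rewrite /D' eqxx.
  have := @taylor_deriv D' n x y; rewrite D'n; apply => j jn.
  rewrite /D' ifF; last by apply/negbTE; rewrite neq_ltn ltnS jn.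
  have [->|jn'] := eqVneq j n; first by rewrite eqxx.
  rewrite ifF; last by rewrite eqSS (negbTE jn').
  by apply: dD => //; rewrite ltn_neqAle jn'.
have := ac_ftc acT iw dT a01 x01.
have -> : taylor D n x x = D 0%N x.
  rewrite /taylor big_ord_recl/= expr0 fact0 divr1 mulr1 big1 ?addr0// => i _.
  by rewrite subrr expr0n mul0r mulr0.
have -> : taylor D n x a = 0.
  by rewrite /taylor big1// => i _; rewrite Da ?mul0r// -ltnS.
rewrite subr0 => ->; rewrite /primitive; congr Rintegral; apply/funext => t.
by rewrite /taylor_kernel mulrA.
Qed.

End taylor.

Section sobolev_theory.
Variable R : realType.
Notation I01 := (`[0, 1]%classic : set (measurableTypeR R)).
Notation mu := (@lebesgue_measure R).
Implicit Types (v f g : R -> R) (x y t : R) (D : nat -> R -> R).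
Variables (a : R) (q : \bar R) (r : nat).
Hypotheses (a01 : 0 < a < 1) (q1 : (1 <= q)%E) (r0 : (0 < r)%N).

Let mI01 : measurable I01. Proof. exact: measurable_itv. Qed.

Let a01' : 0 <= a <= 1. Proof. by case/andP: a01 => /ltW -> /ltW ->. Qed.

Lemma Lfun_leb01_integrable g : (g : measurableTypeR R ->
  R) \in Lfun (leb01 R) q ->
  (leb01 R).-integrable setT (EFin \o g).
Proof.
move=> gq; apply/Lfun1_integrable; apply: Lfun_subset gq => //.
by rewrite fin_num_measure.
Qed.

Lemma sobolev_eq f g x : sobolev a q r f g -> 0 <= x <= 1 ->
  f x = \int[leb01 R]_t (g t * taylor_kernel r.-1 a x t).
Proof.
move=> [D [Df dD Da acD [dg gq]]] x01; rewrite -Df//.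
apply: taylor_integral => //; last exact: Lfun_leb01_integrable.
- by move=> j y jr y01; apply: dD => //; rewrite -ltn_predRL.
- by move=> j jr; apply: Da; rewrite -(prednK r0).
Qed.

Definition int_kernel t : R :=
  ((fun t : R => (if t < a then - t else 1 - t) ^+ r / r`!%:R) \_ I01) t.

Lemma int_kernelE t : taylor_kernel r a 1 t - taylor_kernel r a 0 t =
  int_kernel t.
Proof.
case/andP: a01 => a0 a1.
rewrite /int_kernel /taylor_kernel /oriented !patchE; case: ifPn => [|_]; last
  by rewrite !mul0r subrr.
rewrite mem_setE in_itv/= => /andP[t0 t1].
rewrite (ltNge t 0) t0/=; case: (ltP t a) => ta.
  have -> : (t < 1) by lra.
  rewrite /= !sub0r; ring.
case: (ltP t 1) => t1' /=; first by ring.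
(* At [t = 1] the oriented weight is 0 whereas [int_kernel] takes the value (1-1)^r / r!; they agree
   because [r] is positive. *)
have -> : t = 1 by lra.
by rewrite !subrr expr0n eqn0Ngt r0 mul0r; ring.
Qed.

Lemma measurable_int_kernel : measurable_fun setT (int_kernel : measurableTypeR
  R -> R).
Proof.
rewrite (_ : int_kernel = fun t =>
  taylor_kernel r a 1 t - taylor_kernel r a 0 t); last first.
  by apply/funext => t; rewrite int_kernelE.
by apply: measurable_funB; exact: measurable_taylor_kernel.
Qed.

Lemma int_kernel_le1 t : `|int_kernel t| <= 1.
Proof.
rewrite /int_kernel patchE; case: ifPn => [|_]; last by rewrite normr0.
rewrite mem_setE in_itv/= => /andP[t0 t1];
  rewrite normrM normfV normrX normr_nat.
rewrite ler_pdivrMr ?ltr0n ?fact_gt0// mul1r (@le_trans _ _ 1)//.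
  by apply: exprn_ile1 => //; rewrite ler_norml; case: ltP => _; apply/andP;
    split; lra.
by rewrite ler1n fact_gt0.
Qed.

Lemma sobolev_ac f g : sobolev a q r f g -> abs_continuous01 f.
Proof.
move=> [D [Df dD Da acD [dg gq]]]; apply: (eq_ac Df).
apply: (chain_ac (n := r.-1)) => // j x jr; apply: dD.
by rewrite -ltn_predRL.
Qed.

(** No exchange of integrals is needed: the primitive of [f] vanishing at [a] is put in front of the
    chain, and Taylor's formula one order higher is evaluated at 1 and at 0. The difference of the
    two Taylor kernels is [int_kernel]. *)
Lemma sobolev_integral f g : sobolev a q r f g ->
  \int[leb01 R]_x (f \_ I01) x = \int[leb01 R]_t (g t * int_kernel t).
Proof.
move=> sfg; have acf := sobolev_ac sfg.
have ifI := ac_integrable acf.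
move: sfg => [D [Df dD Da acD [dg gq]]].
have ig := Lfun_leb01_integrable gq.
pose D' j := if j is j'.+1 then D j' else primitive a (f \_ I01).
have dD' j y : (j < r)%N -> 0 <= y <= 1 -> is_deriv01 (D' j) y (D' j.+1 y).
  move=> jr y01; case: j jr => [|j] jr /=; last exact: dD.
  have -> : D 0%N y = (f \_ I01) y by rewrite patchE mem_set ?Df.
  apply: primitive_deriv => // e e0.
  have [d d0 Hd] := ac_unif acf e0; exists d => // z z01 zy.
  rewrite !patchE !mem_set//; exact/ltW/Hd.
have rep x : 0 <= x <= 1 -> primitive a (f \_ I01) x =
  \int[leb01 R]_t (g t * taylor_kernel r a x t).
  apply: (taylor_integral (D := D')) => //.
  - move=> [|j] jr /=; first exact: primitive_id.
    exact: Da.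
  - by rewrite /D'; case: (r) r0 acD.
  - by rewrite /D'; case: (r) r0 dg.
have i01 : 0 <= (1:R) <= 1 by rewrite ler01 lexx.
have i00 : 0 <= (0:R) <= 1 by rewrite ler01 lexx.
transitivity (primitive a (f \_ I01) 1 - primitive a (f \_ I01) 0).
  rewrite primitiveB// !integral_leb01//; last exact: integrable_oriented.
  have il := leb01_integrable ifI.
  have subco : `[0, 1[%classic `<=` I01.
    by move=> t /=; rewrite !in_itv/= => /andP[-> /ltW ->].
  rewrite -Rintegral_itv_bndo_bndc; last by apply: integrableS il => //;
    exact: subco.
  rewrite -[RHS]Rintegral_itv_bndo_bndc; last first.
    by apply: integrableS (leb01_integrable (integrable_oriented 1 0 ifI)) =>
      //; exact: subco.
  apply: eq_Rintegral => t; rewrite inE/= in_itv/= => /andP[t0 t1].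
  by rewrite /oriented t1 ltNge t0 /= subr0 mulr1.
have ik x : 0 <= x <= 1 -> (leb01 R).-integrable setT (EFin \o (fun t => g t *
  taylor_kernel r a x t)).
  move=> x01; exact: (integrable_mulb ig (measurable_taylor_kernel r a x) (fun
    t => taylor_kernel_le1 r a t x01)).
rewrite !rep// -RintegralB//; try exact: ik.
by congr Rintegral; apply/funext => t; rewrite -mulrBr int_kernelE.
Qed.

(* Cut off outside [0,1], where nothing is known about the measurability of the
   primitive. *)
Definition prim01 v : R -> R := primitive a v \_ I01.

Lemma iter_prim01_integrable g n : (leb01 R).-integrable setT (EFin \o g) ->
  (leb01 R).-integrable setT (EFin \o iter n prim01 g).
Proof. by move=> ig; elim: n => //= n IH; apply: ac_integrable;
  exact: primitive_ac. Qed.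

(** Every L_q function is an r-th derivative: the j-th derivative of the iterate is the iterate of
    order [r - j]. Below the top the integrand is continuous, so differentiation is pointwise; only
    the last step is almost everywhere. *)
Lemma sobolev_iter_prim g : (g : measurableTypeR R -> R) \in Lfun (leb01 R) q ->
  sobolev a q r (iter r prim01 g) g.
Proof.
move=> gq; have ig := Lfun_leb01_integrable gq.
have prim01E v y : 0 <= y <= 1 -> primitive a v y = prim01 v y.
  by move=> y01; rewrite /prim01 patchE mem_set.
have ipr n : abs_continuous01 (iter n.+1 prim01 g).
  by apply: (eq_ac (prim01E (iter n prim01 g))); apply: primitive_ac;
    exact: iter_prim01_integrable.
exists (fun j => iter (r - j) prim01 g); split.
- by rewrite subn0.
- move=> j x jr x01.
  have -> : (r - j = (r - j.+1).+1)%N by lia.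
  rewrite [iter _.+1 _ _]iterS;
    apply: (eq_is_deriv01 (prim01E (iter (r - j.+1) prim01 g))) => //.
  apply: primitive_deriv => //; first exact: iter_prim01_integrable.
  move=> e e0; have -> : (r - j.+1 = (r - j.+2).+1)%N by lia.
  have [d d0 Hd] := ac_unif (ipr (r - j.+2)%N) e0; exists d => // y y01 yx.
  exact/ltW/Hd.
- move=> j jr; have -> : (r - j = (r - j.+1).+1)%N by lia.
  by rewrite iterS /prim01 patchE mem_set// primitive_id.
- have -> : (r - r.-1 = 1)%N by lia.
  exact: ipr.
- split => //.
  have ae01 : \forall x \ae leb01 R, I01 x.
    by exists (~` I01); split => //; [exact: measurableC|exact: leb01_out].
  apply: (@filterS2 _ _ (ae_filter_ringOfSetsType (leb01 R)) _ _ _ _ ae01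
    (primitive_ae_deriv a ig)).
  move=> x x01; have -> : (r - r.-1 = 1)%N by lia.
  by apply: (eq_is_deriv01 (prim01E g)).
Qed.

(** Integration starts at [a], so vanishing on one side is inherited there. The conclusion includes
    [x = a], hence the statement can be iterated. *)
Lemma prim01_lt g : (forall t, t < a -> g t = 0) -> forall x, x <= a ->
  prim01 g x = 0.
Proof.
move=> g0 x xa; rewrite /prim01 patchE; case: ifPn => // _.
rewrite /primitive (_ : (fun t => _) = fun=> 0) ?Rintegral_cst ?mul0r//.
apply/funext => t; rewrite /oriented; case: (ltP t a) => ta; first
  by rewrite g0// mul0r.
by rewrite ltNge (le_trans xa ta)/= subrr mulr0.
Qed.

Lemma prim01_ge g : (forall t, a <= t -> g t = 0) -> forall x, a <= x ->
  prim01 g x = 0.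
Proof.
move=> g0 x xa; rewrite /prim01 patchE; case: ifPn => // _.
rewrite /primitive (_ : (fun t => _) = fun=> 0) ?Rintegral_cst ?mul0r//.
apply/funext => t; rewrite /oriented; case: (leP a t) => ta; first
  by rewrite g0// mul0r.
by rewrite (lt_le_trans ta xa) subrr mulr0.
Qed.

Lemma iter_prim01_lt g : (forall t, t < a -> g t = 0) ->
  forall x, x <= a -> iter r prim01 g x = 0.
Proof.
move=> g0; rewrite -(prednK r0).
elim: r.-1 => [|n IH] /=; first exact: prim01_lt.
by apply: prim01_lt => t ta; apply: IH; exact: ltW.
Qed.

Lemma iter_prim01_ge g : (forall t, a <= t -> g t = 0) ->
  forall x, a <= x -> iter r prim01 g x = 0.
Proof.
move=> g0; rewrite -(prednK r0).
elim: r.-1 => [|n IH] /=; first exact: prim01_ge.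
exact: prim01_ge.
Qed.

End sobolev_theory.

(** * Product kernels on the cube *)

Section integral_product.
Context d1 d2 (T1 : measurableType d1) (T2 : measurableType d2) (R : realType).
Variables (m1 : probability T1 R) (m2 : probability T2 R).

Lemma integral_prod_mul (f : T1 -> R) (g : T2 -> R) :
  m1.-integrable setT (EFin \o f) -> m2.-integrable setT (EFin \o g) ->
  (m1 \x m2)%E.-integrable setT (EFin \o (fun z => f z.1 * g z.2)) /\
  (\int[m1 \x m2]_z (f z.1 * g z.2)%:E)%E =
    ((\int[m1]_x f x)%R * (\int[m2]_y g y)%R)%:E.
Proof.
move=> intf intg.
have mf : measurable_fun setT f by apply/measurable_EFinP;
  exact: measurable_int intf.
have mg : measurable_fun setT g by apply/measurable_EFinP;
  exact: measurable_int intg.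
have mh : measurable_fun setT (EFin \o (fun z : T1 * T2 => f z.1 * g z.2)).
  apply/measurable_EFinP; apply: measurable_funM.
    exact: (measurableT_comp mf measurable_fst).
  exact: (measurableT_comp mg measurable_snd).
have ih : (m1 \x m2)%E.-integrable setT (EFin \o (fun z => f z.1 * g z.2)).
  apply/integrable12ltyP => //=.
  under eq_integral => x _.
    under eq_integral do rewrite normrM EFinM.
    rewrite integralZl//; last exact: integrable_norm intg.
    rewrite muleC.
    over.
  have fg : (\int[m2]_y (`|g y|)%:E)%E \is a fin_num.
    by apply: integrable_fin_num => //; exact: integrable_norm intg.
  rewrite -(fineK fg) integralZl//; last exact: integrable_norm intf.
  rewrite -(@fineK _ (\int[m1]_x (`|f x|)%:E)%E) ?ltry//.
  by apply: integrable_fin_num => //; exact: integrable_norm intf.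
split=> //; rewrite -(integral12_prod_meas1 ih) /fubini_F /=.
under eq_integral => x _.
  under eq_integral do rewrite EFinM.
  rewrite integralZl//.
  rewrite muleC.
  over.
have fg : (\int[m2]_y (g y)%:E)%E \is a fin_num
  by exact: integrable_fin_num intg.
have ff : (\int[m1]_x (f x)%:E)%E \is a fin_num
  by exact: integrable_fin_num intf.
by rewrite -(fineK fg) integralZl// EFinM muleC /Rintegral (fineK ff).
Qed.

End integral_product.

Section lebcube_product.
Variable R : realType.
Implicit Types d : nat.

Lemma measurable_prod_tnth d (w : 'I_d -> R -> R) :
  (forall j, measurable_fun setT (w j)) ->
  measurable_fun setT (fun x : d.-tuple (measurableTypeR R) =>
    \prod_(j < d) w j (tnth x j)).
Proof.
move=> mw; apply: measurable_prod => j _.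
exact: (measurableT_comp (mw j) (measurable_tnth j)).
Qed.

(** Follows the recursive definition of [lebcube]: the integral is pulled back along [tcons], where
    the first factor splits off by Fubini. *)
Lemma lebcube_prod d (w : 'I_d -> R -> R) :
  (forall j, (leb01 R).-integrable setT (EFin \o w j)) ->
  (lebcube R d).-integrable setT (EFin \o (fun x =>
    \prod_(j < d) w j (tnth x j))) /\
  \int[lebcube R d]_x \prod_(j < d) w j (tnth x j) =
    \prod_(j < d) \int[leb01 R]_t w j t.
Proof.
elim: d w => [|d IH] w iw.
  have -> : (fun x : 0.-tuple R => \prod_(j < 0) w j (tnth x j)) = fun=> 1.
    by apply/funext => x; rewrite big_ord0.
  split; first exact: finite_measure_integrable_cst.
  rewrite Rintegral_cst// big_ord0 mul1r.
    by rewrite [X in fine X](probability_setT (lebcube R 0)).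
have mw j : measurable_fun setT (w j).
  by apply/measurable_EFinP; exact: measurable_int (iw j).
have [iW eW] := IH (fun j => w (lift ord0 j)) (fun j => iw _).
have [ih eh] := integral_prod_mul (iw ord0) iW.
have mp := measurable_prod_tnth mw.
have pE : (fun x => \prod_(j < d.+1) w j (tnth x j)) \o @tcons R d =
    fun z => w ord0 z.1 * \prod_(j < d) w (lift ord0 j) (tnth z.2 j).
  apply/funext => -[x y] /=; rewrite big_ord_recl; congr (_ * _).
  by apply: eq_bigr => j _; rewrite tnthS.
have ih' : (leb01 R \x lebcube R d)%E.-integrable setT
   ((EFin \o (fun x => \prod_(j < d.+1) w j (tnth x j))) \o @tcons R d).
  by rewrite -compA pE.
split.
  by apply: integrable_pushforward => //; apply/measurable_EFinP.
rewrite /Rintegral integral_pushforward//; last exact/measurable_EFinP.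
rewrite preimage_setT -compA pE eh /= eW big_ord_recl//.
Qed.

End lebcube_product.

(** * Hölder's inequality for conjugate exponents, including the pair 1 and infinity *)

Section hoelder_conjugates.
Context d (T : measurableType d) (R : realType) (P : probability T R).
Variables (p : R) (q : \bar R).
Hypotheses (q1 : (1 < q)%E) (pq : (p%:E^-1 + q^-1 = 1)%E).

Lemma hoelder_conj_cases : (q = +oo%E /\ p = 1) \/
  exists q' : R, [/\ q = q'%:E, 1 < q', 1 < p & p^-1 + q'^-1 = 1].
Proof.
move: q1 pq; case: (q) => [s|_|//].
(* The extended inverse of 0 is [+oo], so [p = 0] contradicts the conjugacy equation. *)
- rewrite lte_fin => s1; rewrite !inver; have [p0|p0] := eqVneq p 0.
    by case: ifPn.
  rewrite gt_eqF ?(lt_trans ltr01)// -EFinD => -[ps]; right; exists s;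
    split => //.
  have s0 : 0 < s by apply: lt_trans s1.
  have is1 : s^-1 < 1 by rewrite invf_lt1.
  have is0 : 0 < s^-1 by rewrite invr_gt0.
  have ip : p^-1 = 1 - s^-1 by lra.
  have ip0 : 0 < p^-1 by lra.
  have p_gt0 : 0 < p by rewrite -invr_gt0.
  by rewrite -invf_lt1//; lra.
- rewrite invey adde0 inver; case: eqP => // _ [ip]; left; split => //.
  by rewrite -(invrK p) ip invr1.
Qed.

Lemma hoelder_conj_ge1 : 1 <= p.
Proof. by case: hoelder_conj_cases => [[_ ->//]|[s [_ _ /ltW]]]. Qed.

Lemma hoelder_conj_norm (f g : T -> R) : measurable_fun setT f ->
  measurable_fun setT g ->
  ('N[P]_q[EFin \o g] < +oo)%E ->
  (\int[P]_x `|f x * g x|%:E <= 'N[P]_p%:E[EFin \o f] * 'N[P]_q[EFin \o g])%E.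
Proof.
move=> mf mg.
case: hoelder_conj_cases => [[-> ->]|[s [-> s1 p1 ps]]] gfin; last first.
  have := hoelder P mf mg (lt_trans ltr01 p1) (lt_trans ltr01 s1) ps.
  by rewrite Lnorm1.
(* At [+oo] the norm unfolds to the essential supremum under a guard of positive total mass, here 1.
   The inequality is then the pointwise bound of |f g| by |f| times this supremum, almost
   everywhere. *)
have gE : ('N[P]_+oo[EFin \o g] = ess_sup P (abse \o (EFin \o g)))%E.
  by rewrite unlock /Lnorm [X in (_ < X)%E](probability_setT P) lte01.
have S0 := Lnorm_ge0 P +oo%E (EFin \o g).
rewrite Lnorm1.
have Sfin : 'N[P]_+oo[EFin \o g]%E \is a fin_num by rewrite ge0_fin_numE.
have mnf : measurable_fun setT (fun x => `|f x|%:E).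
  by apply/measurable_EFinP; exact: measurableT_comp.
rewrite -(fineK Sfin) muleC -(ge0_integralZl_EFin P measurableT _ mnf)//;
  last exact: fine_ge0.
apply: ae_ge0_le_integral => //.
- by apply/measurable_EFinP; apply: measurableT_comp => //;
    exact: measurable_funM.
- by move=> x _; rewrite mule_ge0// lee_fin fine_ge0.
- exact: measurable_funeM.
have := ess_sup_ge P (abse \o (EFin \o g)); rewrite -gE -(fineK Sfin).
apply: (@filterS _ _ (ae_filter_ringOfSetsType P)).
move=> x /= gS _; rewrite normrM EFinM muleC; apply: lee_wpmul2r => //.
Qed.

(** Hölder against the constant 1, whose norm is 1 on a probability space; it turns L_q convergence
    into L_1 convergence. *)
Lemma integral_le_Lnorm (g : T -> R) : measurable_fun setT g ->
  ('N[P]_q[EFin \o g] < +oo)%E ->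
  (\int[P]_x `|g x|%:E <= 'N[P]_q[EFin \o g])%E.
Proof.
move=> mg gfin.
have := hoelder_conj_norm (measurable_cst (1:R)) mg gfin.
under eq_integral do rewrite /= mul1r.
move=> /le_trans; apply; rewrite (Lnorm_cst1 P p) [X in (X `^
  _)%E](probability_setT P).
by rewrite poweR1r mul1e.
Qed.

End hoelder_conjugates.

(** * Kernel representation on the algebraic tensor product *)

Section tensor.
Variable R : realType.
Variables (a : R) (p : R) (q : \bar R) (r d : nat).
Hypotheses (a01 : 0 < a < 1) (q1 : (1 < q)%E) (pq : (p%:E^-1 + q^-1 = 1)%E).
Hypothesis r0 : (0 < r)%N.
Local Notation pt := (d.-tuple (measurableTypeR R)).
Notation I01 := (`[0, 1]%classic : set (measurableTypeR R)).
Notation P := (lebcube R d).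
Implicit Types f g : pt -> R.

Let qge1 : (1 <= q)%E. Proof. exact: ltW. Qed.

Lemma Rintegral_lebcube_sum (m : nat) (F : 'I_m -> pt -> R) :
  (forall i, P.-integrable setT (EFin \o F i)) ->
  P.-integrable setT (EFin \o (fun x => \sum_(i < m) F i x)) /\
  \int[P]_x \sum_(i < m) F i x = \sum_(i < m) \int[P]_x F i x.
Proof.
move=> iF; split.
  rewrite (_ : _ \o _ = fun x => (\sum_(i < m) (F i x)%:E)%E); last first.
    by apply/funext => x; rewrite sumEFin.
  by apply: integrable_sum => // i _; exact: iF.
rewrite /Rintegral sum_fine; last by move=> i _;
  apply: integrable_fin_num => //; exact: iF.
congr fine; rewrite -(integral_sum measurableT iF).
by apply: eq_integral => x _; rewrite sumEFin.
Qed.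

Lemma alg_tensor_pairing (m : nat) (v : 'I_m -> 'I_d -> R -> R) (k : 'I_d ->
  R -> R) M :
  (forall i j, (leb01 R).-integrable setT (EFin \o v i j)) ->
  (forall j, measurable_fun setT (k j)) -> (forall j t, `|k j t| <= M) ->
  \int[P]_t ((\sum_(i < m) \prod_(j < d) v i j (tnth t j)) *
    \prod_(j < d) k j (tnth t j)) =
  \sum_(i < m) \prod_(j < d) \int[leb01 R]_t (v i j t * k j t).
Proof.
move=> iv mk kM.
have ivk i j : (leb01 R).-integrable setT (EFin \o (fun t => v i j t * k j t)).
  exact: (integrable_mulb (iv i j) (mk j) (kM j)).
have H i := lebcube_prod (ivk i).
have [_ E] := Rintegral_lebcube_sum (fun i => (H i).1).
under [RHS]eq_bigr do rewrite -(H _).2.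
rewrite -E; congr Rintegral; apply/funext => t.
by rewrite mulr_suml; apply: eq_bigr => i _; rewrite -big_split.
Qed.

(** Evaluation and integration depend on [g] alone, through bounded product kernels. No trace of the
    chosen elementary tensors is left, which is what permits passing to the limit. *)
Lemma alg_tensorP f g : alg_tensor a q r f g ->
  [/\ P.-integrable setT (EFin \o g), measurable_fun setT (f \_ (cube R d)),
    forall x, cube R d x ->
      f x = \int[P]_t (g t * \prod_(j < d) taylor_kernel r.-1 a (tnth x j)
        (tnth t j)) &
    \int[P]_x (f \_ (cube R d)) x =
      \int[P]_t (g t * \prod_(j < d) int_kernel a r (tnth t j))].
Proof.
move=> [m [u [v [uv fE gE]]]].
have iv i j : (leb01 R).-integrable setT (EFin \o v i j).
  apply: (Lfun_leb01_integrable qge1).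
  by have [D [_ _ _ _ []]] := uv i j.
have iu i j : (leb01 R).-integrable setT (EFin \o (u i j \_ I01)).
  exact: ac_integrable (sobolev_ac (uv i j)).
have HU i := lebcube_prod (iu i).
have HV i := lebcube_prod (iv i).
have [iU EU] := Rintegral_lebcube_sum (fun i => (HU i).1).
have [iV EV] := Rintegral_lebcube_sum (fun i => (HV i).1).
have gE' : g = fun x => \sum_(i < m) \prod_(j < d) v i j (tnth x j)
  by exact/funext.
have fE' : f \_ (cube R d) =
  fun x => \sum_(i < m) \prod_(j < d) (u i j \_ I01) (tnth x j).
  apply/funext => x; rewrite patchE; case: ifPn => [|nx].
    rewrite inE => cx; rewrite fE//; apply: eq_bigr => i _;
      apply: eq_bigr => j _.
    by rewrite patchE mem_set//= in_itv/=; exact: cx.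
  (* Off the cube some coordinate leaves [0,1] and its cut-off factor is zero, so cutting off [f]
     amounts to cutting off every univariate factor. *)
  have [j xj] : exists j, ~ (0 <= tnth x j <= 1).
    by apply/existsNP => H; move: nx; rewrite notin_setE; apply => j; exact: H.
  rewrite big1// => i _; rewrite (bigD1 j)//= patchE memNset ?mul0r//= in_itv/=.
split.
- by rewrite gE'.
- by rewrite fE'; apply/measurable_EFinP; exact: measurable_int iU.
- move=> x cx; rewrite fE// gE'.
  rewrite (@alg_tensor_pairing _ v (fun j =>
    taylor_kernel r.-1 a (tnth x j)) 1)//.
  + by apply: eq_bigr => i _; apply: eq_bigr => j _;
      apply: (sobolev_eq a01 qge1 r0 (uv i j)); exact: cx.
  + by move=> j; exact: measurable_taylor_kernel.
  + by move=> j t; apply: taylor_kernel_le1; exact: cx.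
- rewrite fE' gE' EU.
  rewrite (@alg_tensor_pairing _ v (fun j => int_kernel a r) 1)//.
  + apply: eq_bigr => i _; rewrite (HU i).2; apply: eq_bigr => j _.
    exact: (sobolev_integral a01 qge1 r0 (uv i j)).
  + by move=> j; exact: measurable_int_kernel.
  + by move=> j t; exact: int_kernel_le1.
Qed.

End tensor.

(** * The integral on the completion and the upper bound for the initial error *)

Section tensor_integral.
Variable R : realType.
Variables (a : R) (p : R) (q : \bar R) (r d : nat).
Hypotheses (a01 : 0 < a < 1) (q1 : (1 < q)%E) (pq : (p%:E^-1 + q^-1 = 1)%E).
Hypothesis r0 : (0 < r)%N.
Local Notation pt := (d.-tuple (measurableTypeR R)).
Notation P := (lebcube R d).
Implicit Types f g : pt -> R.

Let qge1 : (1 <= q)%E. Proof. exact: ltW. Qed.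

Lemma prod_tnth_le1 (k : 'I_d -> R ->
  R) (t : pt) : (forall j s, `|k j s| <= 1) ->
  `|\prod_(j < d) k j (tnth t j)| <= 1.
Proof. by move=> k1; rewrite normr_prod; apply: prodr_ile1 => j _;
  rewrite normr_ge0 k1. Qed.

Lemma Rintegral_mul_le (g h : pt -> R) : P.-integrable setT (EFin \o g) ->
  measurable_fun setT h -> (forall t, `|h t| <= 1) ->
  `|\int[P]_t (g t * h t)| <= \int[P]_t `|g t|.
Proof.
move=> ig mh h1; apply: le_normr_Rintegral_bound.
- exact: integrable_mulb ig mh h1.
- exact: integrable_norm ig.
- by move=> t; rewrite normrM ler_piMr.
Qed.

(** The integrals of the approximants have two limits. Dominated convergence gives the integral of
    [f]; the kernel formula gives the pairing with [g], since the kernel is bounded by 1 and the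
    derivatives converge in L_1. *)
Theorem tensor_integral f g : tensor_space a q r f g ->
  integral_cube f = \int[P]_t (g t * \prod_(j < d) int_kernel a r (tnth t j)).
Proof.
move=> [gq [fn [gn [alg cvN cvf]]]].
have A n := alg_tensorP a01 q1 r0 (alg n).
have ig : P.-integrable setT (EFin \o g).
  by apply/Lfun1_integrable; apply: Lfun_subset gq => //;
    rewrite fin_num_measure.
have ign n : P.-integrable setT (EFin \o gn n) by case: (A n).
have id_ n : P.-integrable setT (EFin \o (fun t => gn n t - g t)).
  by have := integrableB measurableT (ign n) ig.
pose Phi t := \prod_(j < d) int_kernel a r (tnth t j).
have mPhi : measurable_fun setT Phi.
  by apply: (measurable_prod_tnth (w := fun=> int_kernel a r)) => j;
    exact: measurable_int_kernel.
have Phi1 t : `|Phi t| <= 1 by apply: (@prod_tnth_le1 (fun=> int_kernel a r))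
  => j s; exact: int_kernel_le1.
pose dl n := \int[P]_t `|gn n t - g t|.
have dlE n : (dl n)%:E = (\int[P]_t `|gn n t - g t|%:E)%E.
  by rewrite fineK//; apply: integrable_fin_num => //;
    exact: integrable_norm (id_ n).
have dl0 : dl @ \oo --> 0.
  apply: (@fine_cvg _ _ _ _ (fun n => (dl n)%:E)).
  apply: (@squeeze_cvge _ _ _ _ (fun=> 0%E) _ _ _ 0%E _ cvN);
    last exact: cvg_cst.
  apply: nearW => n; rewrite lee_fin Rintegral_ge0//=.
  have [Ny|Ny] := eqVneq ('N[P]_q[EFin \o (gn n \- g)%R])%E +oo%E; first
    by rewrite Ny leey.
  rewrite dlE; apply: (integral_le_Lnorm q1 pq); last by rewrite ltey.
  by apply/measurable_EFinP; exact: measurable_int (id_ n).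
(* The L_1 distances converge, hence are bounded. Through the Taylor kernel, [B] then bounds every
   approximant on the cube and serves as the dominating constant. *)
have [B HB] : exists B, forall n, \int[P]_t `|gn n t| <= B.
  have [M [_ HM]] := cvg_seq_bounded (cvgP _ dl0).
  exists (M + 1 + \int[P]_t `|g t|) => n.
  have := HM (M + 1); rewrite ltrDl ltr01 => /(_ isT n I) /=.
  move=> /(le_trans (ler_norm _)) => dlM.
  apply: (@le_trans _ _ (dl n + \int[P]_t `|g t|)); last by rewrite lerD2r.
  have i1 := integrable_norm (id_ n); have i2 := integrable_norm ig.
  rewrite -RintegralD//; apply: le_Rintegral => //.
  - exact: integrable_norm (ign n).
  - by have := integrableD measurableT i1 i2.
  - by move=> t _; have := ler_normD (gn n t - g t) (g t); rewrite subrK.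
have fB n x : `|(fn n \_ (cube R d)) x| <= B.
  rewrite patchE; case: ifPn => [|_]; last first.
    by rewrite normr0 (le_trans _ (HB 0%N))// Rintegral_ge0.
  rewrite inE => cx; case: (A n) => _ _ -> // _.
  apply: le_trans (HB n); apply: Rintegral_mul_le => //.
    by apply: (measurable_prod_tnth (w :=
      fun j => taylor_kernel r.-1 a (tnth x j))) => j;
      exact: measurable_taylor_kernel.
  by move=> t; apply: (@prod_tnth_le1 (fun j =>
    taylor_kernel r.-1 a (tnth x j))) => j s; apply: taylor_kernel_le1;
    exact: cx.
have cvF x : (fn n \_ (cube R d)) x @[n --> \oo] --> (f \_ (cube R d)) x.
  have [cx|ncx] := pselect (cube R d x).
    rewrite patchE mem_set//; apply: cvg_trans (cvf x cx).
    by apply: near_eq_cvg; apply: nearW => n; rewrite patchE mem_set.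
  rewrite patchE memNset//; apply: cvg_near_cst; apply: nearW => n.
  by rewrite patchE memNset.
have lim1 : (\int[P]_x (fn n \_ (cube R d)) x)%R @[n --> \oo] -->
    (\int[P]_x (f \_ (cube R d)) x)%R.
  have icB : P.-integrable setT (fun=> B%:E)
    by exact: finite_measure_integrable_cst.
  apply: fine_cvg.
  have mfn n : measurable_fun setT (fn n \_ (cube R d)) by case: (A n).
  have mf : measurable_fun setT (f \_ (cube R d))
    by exact: measurable_fun_cvg mfn _.
  rewrite fineK.
    apply: (@dominated_cvg _ _ _ P setT measurableT _ _ (fun=> B%:E)) => //.
    - by move=> n; apply/measurable_EFinP.
    - by move=> x _; apply: cvg_EFin; [exact: nearW|exact: cvF].
    - by move=> n x _; rewrite lee_fin; exact: fB.
  apply: integrable_fin_num => //;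
    apply: (integrable_bounded _ mf (M := B)) => x.
  have cvn : `|(fn n \_ (cube R d)) x| @[n --> \oo] --> `|(f \_ (cube R d)) x|.
    by apply: cvg_norm; exact: cvF.
  rewrite -(cvg_lim _ cvn)//; apply: limr_le; first exact: cvgP cvn.
  by apply: nearW => n; exact: fB.
have lim2 : (\int[P]_x (fn n \_ (cube R d)) x)%R @[n --> \oo] -->
  \int[P]_t (g t * Phi t).
  apply/cvgrPdist_le => e e0; move/cvgrPdist_le : dl0 => /(_ e e0).
  apply: filterS => n; rewrite sub0r normrN => dle.
  case: (A n) => _ _ _ ->; apply: le_trans dle; apply: le_trans (ler_norm _).
  rewrite distrC -RintegralB//; last 2 first.
  - exact: integrable_mulb (ign n) mPhi Phi1.
  - exact: integrable_mulb ig mPhi Phi1.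
  under eq_Rintegral do rewrite -mulrBl.
  exact: Rintegral_mul_le.
rewrite /integral_cube Rintegral_mkcond.
by apply: (cvg_unique _ lim1 lim2).
Qed.

Lemma powR_prod (I : Type) (s : seq I) (F : I -> R) b : (forall i, 0 <= F i) ->
  (\prod_(i <- s) F i) `^ b = \prod_(i <- s) F i `^ b.
Proof.
move=> F0; elim: s => [|i s IH]; first by rewrite !big_nil powR1.
by rewrite !big_cons powRM ?IH// prodr_ge0.
Qed.

(** The p-th power of a product is a product, so its integral factorizes; the exponents [d] and 1/p
    are then interchanged. *)
Lemma Lnorm_prod_tnth (k : R -> R) (M : R) : 1 <= p ->
  measurable_fun setT (k : measurableTypeR R -> R) -> (forall t, `|k t| <= M) ->
  'N[P]_p%:E[EFin \o (fun t : pt => (\prod_(j < d) k (tnth t j))%R)]%E =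
  (((\int[leb01 R]_t `|k t| `^ p) `^ p^-1) ^+ d)%:E.
Proof.
move=> p1 mk kM; have p0 : 0 < p by apply: lt_le_trans p1.
have ik : (leb01 R).-integrable setT (EFin \o (fun t => `|k t| `^ p)).
  apply: (integrable_bounded _ (M := M `^ p)).
    have mnk : measurable_fun setT (fun t : measurableTypeR R => `|k t|).
      exact: (measurableT_comp (@normr_measurable R setT) mk).
    exact: (measurableT_comp (@measurable_powR R p) mnk).
  move=> t; rewrite ger0_norm ?powR_ge0//.
  by apply: (ge0_ler_powR (ltW p0)); rewrite ?nnegrE// (le_trans _ (kM t)).
have [iP eP] := lebcube_prod (fun _ : 'I_d => ik).
rewrite unlock.
have -> : (\int[P]_x (`|(EFin \o (fun t : pt =>
  (\prod_(j < d) k (tnth t j))%R)) x| `^ p))%E =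
    (\int[P]_x (\prod_(j < d) `|k (tnth x j)| `^ p)%R%:E)%E.
  apply: eq_integral => x _ /=; rewrite normr_prod; congr EFin.
  exact: powR_prod.
transitivity (((((\int[leb01 R]_t `|k t| `^ p) ^+ d)%:E) `^ p^-1)%E).
  congr poweR; rewrite -[X in (_ ^+ X)%R](card_ord d) -prodr_const -eP.
  by rewrite /Rintegral fineK//; apply: integrable_fin_num.
rewrite poweR_EFin; congr EFin.
have I0 : 0 <= \int[leb01 R]_t `|k t| `^ p by apply: Rintegral_ge0 => t _;
  exact: powR_ge0.
by rewrite -(powR_mulrn d I0) -(powR_mulrn d (powR_ge0 _ _)) powRAC.
Qed.

Theorem unit_ball_integral f : unit_ball a q r f ->
  `|integral_cube f| <= ((\int[leb01 R]_t `|int_kernel a r t| `^ p) `^ p^-1) ^+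
    d.
Proof.
move=> [g tfg g1]; rewrite (tensor_integral tfg).
have [gq _] := tfg.
have ig : P.-integrable setT (EFin \o g).
  by apply/Lfun1_integrable; apply: Lfun_subset gq => //;
    rewrite fin_num_measure.
have mg : measurable_fun setT g by apply/measurable_EFinP;
  exact: measurable_int ig.
have mPhi : measurable_fun setT (fun t : pt =>
  \prod_(j < d) int_kernel a r (tnth t j)).
  by apply: (measurable_prod_tnth (w := fun=> int_kernel a r)) => j;
    exact: measurable_int_kernel.
have Phi1 (t : pt) : `|\prod_(j < d) int_kernel a r (tnth t j)| <= 1.
  by apply: (@prod_tnth_le1 (fun=> int_kernel a r)) => j s;
    exact: int_kernel_le1.
have igP := integrable_mulb ig mPhi Phi1.
apply: le_trans (le_normr_Rintegral measurableT igP) _.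
have gfin : ('N[P]_q[EFin \o g] < +oo)%E by apply: le_lt_trans g1 _;
  exact: ltry.
have := hoelder_conj_norm q1 pq mPhi mg gfin.
rewrite (@Lnorm_prod_tnth _ 1 (hoelder_conj_ge1 q1 pq))//; last 2 first.
- exact: measurable_int_kernel.
- exact: int_kernel_le1.
move=> H; rewrite -lee_fin fineK; last first.
  by apply: integrable_fin_num => //; exact: integrable_norm igP.
under eq_integral do rewrite mulrC.
apply: (le_trans H).
rewrite -[leRHS]mule1; apply: lee_wpmul2l => //.
by rewrite lee_fin exprn_ge0// powR_ge0.
Qed.

End tensor_integral.

(** * The mass of the kernel on either side of the anchor *)

Section powR_integral.
Variable R : realType.
Notation mu := (@lebesgue_measure R).
Implicit Types b s x : R.

Lemma powR_continuous s x : 0 < x -> {for x, continuous (fun t : R => t `^ s)}.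
Proof.
move=> x0; apply: differentiable_continuous; apply/derivable1_diffP.
by apply: derivable_powR; rewrite in_itv/= andbT.
Qed.

(** The endpoint 0 is separate: the derivative rule for powers covers positive [t] only, and at 0
    positivity of [s] makes the limit 0. *)
Lemma powR_within_continuous s b : 0 < s -> 0 < b ->
  {within `[0, b], continuous (fun t : R => t `^ s)}.
Proof.
move=> s0 b0; apply/(continuous_within_itvP _ b0); split.
- by move=> x; rewrite in_itv/= => /andP[x0 _]; exact: powR_continuous.
- by rewrite powR0 ?gt_eqF//; exact: powR_cvg0.
- by apply: cvg_at_left_filter; exact: powR_continuous.
Qed.

Lemma Rintegral_powR s b : 0 < s -> 0 < b ->
  \int[mu]_(t in `[0, b]) t `^ s = b `^ (s + 1) / (s + 1).
Proof.
move=> s0 b0; have s10 : 0 < s + 1 by rewrite addr_gt0.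
pose F t : R := t `^ (s + 1) / (s + 1).
have Fc x : 0 < x -> {for x, continuous F}.
  by move=> x0; apply: cvgM; [exact: powR_continuous|exact: cvg_cst].
rewrite /Rintegral (@continuous_FTC2 _ _ F)//.
- by rewrite /= /F powR0 ?gt_eqF// mul0r subr0.
- exact: powR_within_continuous.
- split.
  + move=> x; rewrite in_itv/= => /andP[x0 _]; apply: derivableM => //.
    by apply: derivable_powR; rewrite in_itv/= andbT.
  + rewrite {2}/F powR0 ?gt_eqF// mul0r -[X in _ --> X](mul0r (s + 1)^-1).
    by apply: cvgM; [exact: powR_cvg0|exact: cvg_cst].
  + by apply: cvg_at_left_filter; exact: Fc.
- move=> x; rewrite in_itv/= => /andP[x0 _].
  rewrite derive1E deriveM//; last by apply: derivable_powR;
    rewrite in_itv/= andbT.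
  rewrite derive_cst scaler0 add0r.
  have [_ ->] := is_derive1_powR (s + 1) x0.
  rewrite addrK /GRing.scale/= mulrA mulVf ?mul1r//.
  by rewrite gt_eqF.
Qed.

Lemma Rintegral_powR_onem s b : 0 < s -> 0 < b -> b < 1 ->
  \int[mu]_(t in `[1 - b, 1]) (1 - t) `^ s = b `^ (s + 1) / (s + 1).
Proof.
move=> s0 b0 b1; rewrite -Rintegral_powR//.
rewrite (@Rintegration_by_substitution_onem _ (fun t => t `^ s))//.
  by rewrite (ltW b0) ltW.
exact: powR_within_continuous.
Qed.

End powR_integral.

Section kernel_norm.
Variable R : realType.
Variables (a p : R) (r : nat).
Hypotheses (a01 : 0 < a < 1) (p1 : 1 <= p) (r0 : (0 < r)%N).
Notation I01 := (`[0, 1]%classic : set (measurableTypeR R)).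
Notation mu := (@lebesgue_measure R).

(** The anchor [a] belongs to the side [true], as in the case distinction of [int_kernel]. Sides are
    booleans so that orthants are boolean vectors. *)
Definition side (b : bool) (t : R) : R :=
  if b then (a <= t)%R%:R else (t < a)%R%:R.

Lemma measurable_side b : measurable_fun setT (side b : measurableTypeR R -> R).
Proof.
case: b; last exact: measurable_lt.
rewrite (_ : side true = fun t => 1 - (t < a)%R%:R); last first.
  by apply/funext => t; rewrite /side; case: leP => _; rewrite ?subr0 ?subrr.
by apply: measurable_funB => //; exact: measurable_lt.
Qed.

Lemma side_le1 b t : `|side b t| <= 1.
Proof. by rewrite /side; case: b; case: (ltP t a) => _ /=;
  rewrite ?normr1 ?normr0. Qed.

Lemma sideD t : side false t + side true t = 1.
Proof. rewrite /side/=; case: (ltP t a) => _ /=; by rewrite ?addr0 ?add0r. Qed.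

Definition kernel_mass (b : bool) : R :=
  \int[leb01 R]_t (`|int_kernel a r t| `^ p * side b t).

Let p0 : 0 < p. Proof. exact: lt_le_trans p1. Qed.

Lemma measurable_int_kernel_powR e :
  measurable_fun setT (fun t : measurableTypeR R => `|int_kernel a r t| `^ e).
Proof.
have mnk : measurable_fun setT (fun t : measurableTypeR R =>
  `|int_kernel a r t|).
  exact: (measurableT_comp (@normr_measurable R setT) (measurable_int_kernel
    a01 r0)).
exact: (measurableT_comp (@measurable_powR R e) mnk).
Qed.

Lemma int_kernel_powR_le1 e t : 0 <= e -> `|int_kernel a r t| `^ e <= 1.
Proof.
move=> e0; rewrite -[leRHS](_ : 1 `^ e = 1); last by rewrite powR1.
by apply: (ge0_ler_powR e0); rewrite ?nnegrE// int_kernel_le1.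
Qed.

Lemma integrable_int_kernel_powR : (leb01 R).-integrable setT (EFin \o (fun t
  => `|int_kernel a r t| `^ p)).
Proof.
apply: (integrable_bounded _ (measurable_int_kernel_powR p) (M := 1)) => t.
by rewrite ger0_norm ?powR_ge0// int_kernel_powR_le1// ltW.
Qed.

Lemma integrable_kernel_mass b :
  (leb01 R).-integrable setT (EFin \o (fun t => `|int_kernel a r t| `^ p *
    side b t)).
Proof. exact: (integrable_mulb integrable_int_kernel_powR (measurable_side b)
  (side_le1 b)). Qed.

Lemma kernel_massD : \int[leb01 R]_t `|int_kernel a r t| `^ p =
  kernel_mass false + kernel_mass true.
Proof.
rewrite /kernel_mass -RintegralD//;
  [|exact: integrable_kernel_mass|exact: integrable_kernel_mass].
by apply: eq_Rintegral => t _; rewrite -mulrDr sideD mulr1.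
Qed.

(** On each side |K|^p is a constant times the power [r%:R * p] of the distance to the end of [0,1]
    on that side; the reflection t -> 1 - t reduces the right side to the integral of a power from
    0. *)
Lemma kernel_massE b : kernel_mass b =
  (if b then 1 - a else a) `^ (r%:R * p + 1) *
   ((r`!%:R^-1) `^ p / (r%:R * p + 1)).
Proof.
have /andP[a0 a1] := a01.
have rp0 : 0 < r%:R * p by rewrite mulr_gt0// ltr0n.
have f0 : 0 <= r`!%:R^-1 :> R by rewrite invr_ge0.
have kE t : 0 <= t <= 1 -> `|int_kernel a r t| `^ p =
    (r`!%:R^-1) `^ p * (if t < a then t else 1 - t) `^ (r%:R * p).
  move=> /andP[t0 t1]; rewrite /int_kernel patchE mem_set//= ?in_itv/= ?t0//.
  have x0 : 0 <= (if t < a then t else 1 - t) by case: ifP => _ //;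
    rewrite subr_ge0.
  rewrite normrM normrX (_ : `|if _ then _ else _| =
    (if t < a then t else 1 - t)).
    by rewrite normfV normr_nat powRM ?exprn_ge0// mulrC powRrM powR_mulrn.
  by case: ifP => _; rewrite ?normrN ger0_norm// subr_ge0.
rewrite /kernel_mass integral_leb01; last exact: integrable_kernel_mass.
have ipow (i : interval R) (h : R -> R) : measurable_fun setT h ->
    (forall t, [set` i] t -> 0 <= t <= 1 /\ 0 <= h t <= 1) ->
    mu.-integrable [set` i] (EFin \o (fun t => h t `^ (r%:R * p))).
  move=> mh h01; apply: measurable_bounded_integrable.
  - exact: measurable_itv.
  - apply: (@le_lt_trans _ _ (mu I01)).
      apply: le_measure; rewrite ?inE;
        [exact: measurable_itv|exact: measurable_itv|].
      by move=> t /h01[t01 _]; rewrite /= in_itv.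
    by rewrite lebesgue_measure_itv/= lte_fin ltr01 -EFinB ltry.
  - by apply: measurable_funTS; exact: (measurableT_comp (@measurable_powR R
      (r%:R * p)) mh).
  exists 1; split; first exact: num_real.
  move=> N N1 t /h01[_ /andP[ht0 ht1]] /=; rewrite ger0_norm ?powR_ge0//.
  apply: le_trans (ltW N1); rewrite -[leRHS](_ : 1 `^ (r%:R * p) = 1); last
    by rewrite powR1.
  by apply: (ge0_ler_powR (ltW rp0)); rewrite ?nnegrE.
case: b.
- transitivity (\int[mu]_(t in `[a, 1]) ((r`!%:R^-1) `^ p * (1 - t) `^ (r%:R *
    p))).
    rewrite Rintegral_mkcond [RHS]Rintegral_mkcond; congr Rintegral;
      apply/funext => t.
    rewrite !patchE !mem_setE !in_itv/= /side.
    have [at_|ta] := leP a t; last by rewrite mulr0 if_same.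
    rewrite (le_trans (ltW a0) at_) mulr1; case: ifP => // t1.
    by rewrite kE ?ltNge ?at_// (le_trans (ltW a0) at_).
  rewrite RintegralZl//; last first.
    apply: (ipow `[a, 1] (fun t => 1 - t)); first exact: measurable_funB.
    by move=> t /=; rewrite in_itv/= => /andP[? ?]; split; apply/andP; split;
      lra.
  have := @Rintegral_powR_onem _ (r%:R * p) (1 - a) rp0.
  rewrite opprB addrCA subrr addr0 => ->; [|lra|lra].
  by ring.
- transitivity (\int[mu]_(t in `[0, a[) ((r`!%:R^-1) `^ p * t `^ (r%:R * p))).
    rewrite Rintegral_mkcond [RHS]Rintegral_mkcond; congr Rintegral;
      apply/funext => t.
    rewrite !patchE !mem_setE !in_itv/= /side.
    have [ta|at_] := ltP t a; last by rewrite mulr0 andbF if_same.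
    rewrite (le_trans (ltW ta) (ltW a1)) mulr1 !andbT; case: ifP => // t0.
    by rewrite kE ?ta// t0 (le_trans (ltW ta) (ltW a1)).
  rewrite RintegralZl//; last first.
    apply: (ipow `[0, a[ id) => // t /=; rewrite in_itv/= => /andP[? ?].
    by split; apply/andP; split; lra.
  rewrite Rintegral_itv_bndo_bndc; last first.
    apply: (ipow `[0, a[ id) => // t /=; rewrite in_itv/= => /andP[? ?].
    by split; apply/andP; split; lra.
  by rewrite Rintegral_powR//; ring.
Qed.

Lemma kernel_mass_gt0 b : 0 < kernel_mass b.
Proof.
have /andP[a0 a1] := a01.
rewrite kernel_massE mulr_gt0//; first by case: b; rewrite powR_gt0// subr_gt0.
by rewrite divr_gt0 ?powR_gt0 ?addr_gt0 ?mulr_gt0 ?invr_gt0 ?ltr0n ?fact_gt0.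
Qed.

Lemma kernel_mass_ratio :
  (1 + ((Num.max a (1 - a))^-1 - 1) `^ (r%:R * p + 1)) *
    Num.max (kernel_mass false) (kernel_mass true) =
  kernel_mass false + kernel_mass true.
Proof.
have /andP[a0 a1] := a01.
have a1' : 0 < 1 - a by rewrite subr_gt0.
rewrite !kernel_massE; set s := _ + 1; set k := _ / _.
have s0 : 0 < s by rewrite addr_gt0// mulr_gt0// ltr0n.
have k0 : 0 < k.
  by rewrite divr_gt0// powR_gt0// invr_gt0 ltr0n fact_gt0.
(* Symmetric form with [y] the larger of a and 1 - a: then y^-1 - 1 = x / y, and multiplying its
   power by y^s restores x^s. *)
have key (x y : R) : 0 < x -> x <= y -> x + y = 1 ->
    (1 + (y^-1 - 1) `^ s) * Num.max (x `^ s * k) (y `^ s * k) =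
      x `^ s * k + y `^ s * k.
  move=> x0 xy xy1; have y0 : 0 < y by apply: lt_le_trans xy.
  have -> : y^-1 - 1 = x * y^-1 by rewrite (_ : x = 1 - y);
    [rewrite mulrBl mul1r divff// gt_eqF|lra].
  rewrite powRM ?(ltW x0) ?invr_ge0 ?(ltW y0)//.
  have xys : x `^ s <= y `^ s by apply: (ge0_ler_powR (ltW s0));
    rewrite ?nnegrE// ltW.
  rewrite (max_idPr _); last by rewrite ler_wpM2r// ltW.
  have : (y^-1) `^ s * y `^ s = 1
    by rewrite -powRM ?mulVf ?powR1 ?gt_eqF ?invr_ge0// ltW.
  by rewrite mulrDl mul1r addrC => H; congr (_ + _);
    rewrite mulrA -[_ * _ * y `^ s]mulrA H mulr1.
have aE : a + (1 - a) = 1 by ring.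
have [aa|/ltW aa] := leP a (1 - a); first by have := key _ _ a0 aa aE.
by rewrite maxC (key _ _ a1' aa) ?subrK// addrC.
Qed.

End kernel_norm.

(** * Fooling functions *)

Section bounded_Lfun.
Context d0 (T : measurableType d0) (R : realType) (P : probability T R).

Lemma bounded_Lfun (q : \bar R) (f : T -> R) M : (1 <= q)%E ->
  measurable_fun setT f ->
  (forall x, `|f x| <= M) -> f \in Lfun P q.
Proof.
move=> q1 mf fM.
have : f \in Lfun P +oo%E.
  apply/andP; split; first by rewrite inE.
  rewrite inE/= /finite_norm unlock /=; case: ifP => // _.
  apply: (@le_lt_trans _ _ M%:E); last exact: ltry.
  by apply: ess_sup_ler => t; rewrite lee_fin.
by apply: Lfun_subset => //; rewrite ?fin_num_measure// leey.
Qed.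

Lemma le_Lnorm_norm (q : \bar R) (f g : T -> R) : (1 <= q)%E ->
  measurable_fun setT f -> measurable_fun setT g ->
  (forall x, `|f x| <= `|g x|) ->
  ('N[P]_q[EFin \o f] <= 'N[P]_q[EFin \o g])%E.
Proof.
move=> q1 mf mg fg; rewrite unlock.
case: q q1 => [s s1|_|//]; last first.
  case: ifP => // _.
  by apply: le_ess_sup; apply: nearW => x; rewrite /= lee_fin.
have s0 : 0 < s by rewrite -lte_fin; apply: lt_le_trans s1; rewrite lte_fin.
have mps (h : T -> R) : measurable_fun setT h ->
    measurable_fun setT (fun x => (`|h x| `^ s)%:E).
  move=> mh; apply/measurable_EFinP;
    apply: (measurableT_comp (@measurable_powR R s)).
  exact: measurableT_comp.
apply: gt0_ler_poweR.
- by rewrite invr_ge0 ltW.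
- by rewrite in_itv/= leey andbT integral_ge0// => x _; exact: poweR_ge0.
- by rewrite in_itv/= leey andbT integral_ge0// => x _; exact: poweR_ge0.
apply: ge0_le_integral => //; try exact: mps; first by move=> x _;
  exact: poweR_ge0.
move=> x _ /=; rewrite lee_fin; apply: (ge0_ler_powR (ltW s0));
  rewrite ?nnegrE//.
Qed.

End bounded_Lfun.

Section fooling.
Variable R : realType.
Variables (a : R) (p : R) (q : \bar R) (r d : nat).
Hypotheses (a01 : 0 < a < 1) (q1 : (1 < q)%E) (pq : (p%:E^-1 + q^-1 = 1)%E).
Hypothesis r0 : (0 < r)%N.
Local Notation pt := (d.-tuple (measurableTypeR R)).
Notation P := (lebcube R d).
Notation K := (int_kernel a r).
Notation orthant := {ffun 'I_d -> bool}.
Notation mass := (kernel_mass a p r).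

Let qge1 : (1 <= q)%E. Proof. exact: ltW. Qed.
Let p1 : 1 <= p. Proof. exact: hoelder_conj_ge1 q1 pq. Qed.
Let p0 : 0 < p. Proof. exact: lt_le_trans p1. Qed.

Definition total_mass : R := \int[leb01 R]_t `|K t| `^ p.

Lemma total_massE : total_mass = mass false + mass true.
Proof. exact: kernel_massD. Qed.

Lemma total_mass_gt0 : 0 < total_mass.
Proof. by rewrite total_massE addr_gt0// kernel_mass_gt0. Qed.

(** The L_q norm of |K|^(p-1), as 1 - 1/p = 1/q. For p = 1 it equals 1, the right value for q
    infinite, so both cases share one formula. *)
Definition scale : R := total_mass `^ (1 - p^-1).

Lemma scale_gt0 : 0 < scale. Proof. by rewrite powR_gt0// total_mass_gt0. Qed.

(* [extremal false + extremal true] attains equality in Hoelder's inequality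
   against the kernel, and [envelope] is its absolute value. *)
Definition envelope (t : R) : R := scale^-1 * `|K t| `^ (p - 1).

Definition extremal (b : bool) (t : R) : R :=
  envelope t * (Num.sg (K t) * side a b t).

Let p10 : 0 <= p - 1. Proof. by rewrite subr_ge0. Qed.

Lemma envelope_ge0 t : 0 <= envelope t.
Proof. by rewrite mulr_ge0 ?powR_ge0// invr_ge0 ltW// scale_gt0. Qed.

Lemma envelope_le t : envelope t <= scale^-1.
Proof. by rewrite /envelope ler_piMr ?int_kernel_powR_le1// invr_ge0 ltW//
  scale_gt0. Qed.

Lemma measurable_envelope : measurable_fun setT (envelope : measurableTypeR R
  -> R).
Proof. by apply: measurable_funM => //; exact: measurable_int_kernel_powR. Qed.

Lemma extremal_le b t : `|extremal b t| <= envelope t * side a b t.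
Proof.
rewrite /extremal normrM (ger0_norm (envelope_ge0 t)) ler_wpM2l ?envelope_ge0//
  normrM.
have s0 : 0 <= side a b t by rewrite /side; case: b; exact: ler0n.
rewrite (ger0_norm s0) ler_piMl// normr_sg.
by case: (_ != _).
Qed.

Lemma extremal_bound b t : `|extremal b t| <= scale^-1.
Proof.
apply: (le_trans (extremal_le b t)); apply: le_trans (envelope_le t).
by rewrite ler_piMr ?envelope_ge0// (le_trans (ler_norm _))// side_le1.
Qed.

Lemma measurable_extremal b : measurable_fun setT (extremal b : measurableTypeR
  R -> R).
Proof.
apply: measurable_funM; first exact: measurable_envelope.
apply: measurable_funM; last exact: measurable_side.
have mK := measurable_int_kernel a01 r0.
rewrite (_ : (fun _ => _) = (fun t => (0 < K t)%R%:R - (K t < 0)%R%:R));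
  last first.
  by apply/funext => t; case: sgrP => _ /=; rewrite ?subrr ?subr0 ?sub0r.
have mlt (A : set R) : measurable A ->
    measurable_fun setT (fun t : measurableTypeR R => \1_A (K t) : R).
  move=> mA; exact: (measurableT_comp (measurable_indic mA) mK).
apply: measurable_funB.
- rewrite (_ : (fun _ => _) = (fun t => \1_(`]0, +oo[%classic : set R) (K t))).
    by apply: mlt; exact: measurable_itv.
  by apply/funext => t; rewrite indicE mem_setE in_itv/= andbT.
- rewrite (_ : (fun _ => _) = (fun t => \1_(`]-oo, 0[%classic : set R) (K t))).
    by apply: mlt; exact: measurable_itv.
  by apply/funext => t; rewrite indicE mem_setE in_itv/=.
Qed.

(** The sign in [extremal] turns K into |K|, and |K|^(p-1) |K| = |K|^p. *)
Lemma integral_extremal_int_kernel b : \int[leb01 R]_t (extremal b t * K t) =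
  scale^-1 * mass b.
Proof.
rewrite /kernel_mass -RintegralZl//; last exact: integrable_kernel_mass.
apply: eq_Rintegral => t _; rewrite /extremal /envelope.
rewrite -(mulr_powRB1 (normr_ge0 (K t)) p0); set A := _ `^ _.
rewrite normrEsg; ring.
Qed.

(** Conjugacy gives (p-1)s = p, so the s-th power of [envelope] is proportional to |K|^p, and
    [scale] normalizes it. *)
Lemma integral_envelope s : 1 < s -> p^-1 + s^-1 = 1 ->
  \int[leb01 R]_t `|envelope t| `^ s = 1.
Proof.
move=> s1 ps; have s0 : 0 < s by apply: lt_trans s1.
have psE : (p - 1) * s = p.
  have pE : p^-1 = 1 - s^-1 by lra.
  have : s = p * (s - 1).
    have -> : s - 1 = s * p^-1 by rewrite pE mulrBr mulr1 divff// gt_eqF.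
    by rewrite mulrCA divff ?mulr1// gt_eqF.
  by move=> sE; rewrite mulrBl mul1r {2}sE; ring.
have nE : scale `^ s = total_mass.
  rewrite /scale -powRrM (_ : 1 - p^-1 = s^-1); last by lra.
  by rewrite mulVf ?gt_eqF// powRr1// ltW// total_mass_gt0.
transitivity (\int[leb01 R]_t (total_mass^-1 * `|K t| `^ p)).
  apply: eq_Rintegral => t _; rewrite ger0_norm ?envelope_ge0// /envelope.
  rewrite powRM ?powR_ge0 ?invr_ge0 ?(ltW scale_gt0)// -powRrM psE;
    congr (_ * _).
  by rewrite -(powR_inv1 (ltW scale_gt0)) -powRrM mulN1r powRN nE.
rewrite RintegralZl//; last exact: integrable_int_kernel_powR.
by rewrite -/total_mass mulVf// gt_eqF// total_mass_gt0.
Qed.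

Lemma Lnorm_envelope : ('N[P]_q[EFin \o (fun t : pt =>
  (\prod_(j < d) envelope (tnth t j))%R)] <= 1)%E.
Proof.
have [[qE pE]|[s [qE s1 p1' ps]]] := hoelder_conj_cases q1 pq.
- have nE : scale = 1 by rewrite /scale pE invr1 subrr powRr0.
  rewrite qE unlock; case: ifP => // _.
  apply: ess_sup_ler => t; rewrite lee_fin;
    apply: (@prod_tnth_le1 R d (fun=> envelope) t) => _ u.
  by rewrite ger0_norm ?envelope_ge0// (le_trans (envelope_le u))// nE invr1.
- rewrite qE (@Lnorm_prod_tnth _ s d envelope scale^-1) ?(ltW s1)//.
  + by rewrite (integral_envelope s1 ps) powR1 expr1n.
  + exact: measurable_envelope.
  + by move=> t; rewrite ger0_norm ?envelope_ge0// envelope_le.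
Qed.

Implicit Types (G : {set orthant}) (x : pt).

Definition spline (b : bool) : R -> R := iter r (prim01 a) (extremal b).

Definition fooling_fun G x : R :=
  \sum_(S in G) \prod_(j < d) spline (S j) (tnth x j).
Definition fooling_deriv G x : R :=
  \sum_(S in G) \prod_(j < d) extremal (S j) (tnth x j).

Lemma fooling_alg_tensor G : alg_tensor a q r (fooling_fun G) (fooling_deriv G).
Proof.
exists #|G|, (fun (i : 'I_#|G|) j => spline ((enum_val i : orthant) j)),
  (fun (i : 'I_#|G|) j => extremal ((enum_val i : orthant) j)).
split.
- move=> i j; apply: (sobolev_iter_prim a01 qge1 r0).
  have H b := bounded_Lfun (leb01 R) qge1 (measurable_extremal b)
    (extremal_bound b).
  exact: H.
- by move=> x _; rewrite /fooling_fun big_enum_val.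
- by move=> x; rewrite /fooling_deriv big_enum_val.
Qed.

(** Nonnegative bounds allow enlarging [G] to all orthants; the sum then factorizes over the
    coordinates, where the two side indicators add up to 1. So discarding splines never raises the
    norm above that of the envelope. *)
Lemma fooling_deriv_le G x : `|fooling_deriv G x| <=
  \prod_(j < d) envelope (tnth x j).
Proof.
have e0 t := envelope_ge0 t.
have s0 b t : 0 <= side a b t by rewrite /side; case: b; exact: ler0n.
pose F j b := envelope (tnth x j) * side a b (tnth x j).
have F0 j b : 0 <= F j b by rewrite mulr_ge0.
apply: (@le_trans _ _ (\sum_(S in G) \prod_(j < d) F j (S j))).
  apply: (le_trans (ler_norm_sum _ _ _)); apply: ler_sum => S _.
  rewrite normr_prod; apply: ler_prod => j _; rewrite normr_ge0/=.
  exact: extremal_le.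
apply: (@le_trans _ _ (\sum_(S : orthant) \prod_(j < d) F j (S j))).
  by rewrite big_mkcond/=; apply: ler_sum => S _; case: ifP => // _;
    exact: prodr_ge0.
rewrite -bigA_distr_bigA/= le_eqVlt; apply/orP; left; apply/eqP.
by apply: eq_bigr => j _; rewrite big_bool /F [LHS]/= -mulrDr addrC sideD mulr1.
Qed.

Lemma measurable_fooling_deriv G : measurable_fun setT (fooling_deriv G).
Proof.
rewrite (_ : fooling_deriv G =
  fun x => \sum_(S <- enum G) \prod_(j < d) extremal (S j) (tnth x j)).
  apply: measurable_sum => S.
  by apply: (measurable_prod_tnth (w := fun j => extremal (S j))) => j;
    exact: measurable_extremal.
by apply/funext => x; rewrite big_enum.
Qed.

Lemma fooling_unit_ball G : unit_ball a q r (fooling_fun G).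
Proof.
exists (fooling_deriv G).
  have ME (x : pt) : `|fooling_deriv G x| <= (scale^-1) ^+ d.
    apply: (le_trans (fooling_deriv_le G x)).
    rewrite -[X in _ ^+ X](card_ord d) -prodr_const; apply: ler_prod => j _.
    by rewrite envelope_ge0/= envelope_le.
  split; first exact: (bounded_Lfun P qge1 (measurable_fooling_deriv G) ME).
  (* The function already lies in the algebraic tensor product, so constant sequences witness
     membership in the completion. *)
  exists (fun=> fooling_fun G), (fun=> fooling_deriv G); split.
  - by move=> _; exact: fooling_alg_tensor.
  - rewrite (_ : EFin \o _ = cst 0%E); last first.
      by apply/funext => x /=; rewrite subrr.
    rewrite Lnorm0; first exact: cvg_cst.
    by rewrite gt_eqF// (lt_le_trans _ qge1).
  - by move=> x _; exact: cvg_cst.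
apply: le_trans Lnorm_envelope.
apply: (le_Lnorm_norm P qge1 (measurable_fooling_deriv G)).
  by apply: (measurable_prod_tnth (w := fun=> envelope)) => j;
    exact: measurable_envelope.
move=> x; apply: (le_trans (fooling_deriv_le G x)).
by rewrite ger0_norm// prodr_ge0// => j _; exact: envelope_ge0.
Qed.

Lemma fooling_integral G :
  integral_cube (fooling_fun G) =
    \sum_(S in G) \prod_(j < d) (scale^-1 * mass (S j)).
Proof.
have [_ _ _ E] := alg_tensorP a01 q1 r0 (fooling_alg_tensor G).
rewrite /integral_cube Rintegral_mkcond E.
transitivity (\int[P]_t ((\sum_(i < #|G|) \prod_(j < d) extremal ((enum_val i :
  orthant) j) (tnth t j)) *
    \prod_(j < d) int_kernel a r (tnth t j))).
  by apply: eq_Rintegral => t _; rewrite /fooling_deriv big_enum_val.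
rewrite (@alg_tensor_pairing _ _ _ (fun (i : 'I_#|G|) j =>
  extremal ((enum_val i : orthant) j)) (fun=> K) 1)//.
- rewrite [RHS]big_enum_val; apply: eq_bigr => i _; apply: eq_bigr => j _.
  exact: integral_extremal_int_kernel.
- move=> i j; apply: (integrable_bounded _ (M := scale^-1)).
    exact: measurable_extremal.
  exact: extremal_bound.
- by move=> j; exact: (measurable_int_kernel a01 r0).
- by move=> j t; exact: int_kernel_le1.
Qed.

(** A node coordinate equal to [a] is counted on the side [false]; the right-hand spline vanishes at
    [a] too, so every node is assigned exactly one orthant. *)
Lemma spline_eq0 b t : b != (a < t) -> spline b t = 0.
Proof.
case: b; rewrite /spline.
  case: ltP => // ta _; apply: (iter_prim01_lt r0) => // s sa.
  by rewrite /extremal /side leNgt sa/= !mulr0.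
case: ltP => // ta _; apply: (iter_prim01_ge r0); last exact: ltW.
by move=> s sa; rewrite /extremal /side ltNge sa/= !mulr0.
Qed.

(* A node determines the only orthant whose product spline may not vanish there. *)
Lemma fooling_eq0 G x : [ffun j => a < tnth x j] \notin G ->
  fooling_fun G x = 0.
Proof.
move=> xG; apply: big1 => S SG.
have [j Sj] : exists j, S j != (a < tnth x j).
  apply/existsP; rewrite -negb_forall; apply: contra xG => /forallP H.
  suff -> : [ffun j => a < tnth x j] = S by [].
  by apply/ffunP => j; rewrite ffunE; apply/esym/eqP.
by rewrite (bigD1 j)//= spline_eq0// mul0r.
Qed.

Definition initial_error1 : R := total_mass `^ p^-1.

(** The full extremal function attains the p-norm of the kernel: the exponents -(1 - 1/p) and 1 add
    up to 1/p. *)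
Lemma initial_error1E : scale^-1 * mass false + scale^-1 * mass true =
  initial_error1.
Proof.
rewrite -mulrDr -total_massE /scale /initial_error1.
have k0 := total_mass_gt0.
rewrite -powR_inv1 ?powR_ge0// -powRrM mulrN1 opprB.
rewrite -[X in _ * X](powRr1 (ltW k0)) -powRD ?subrK//.
by rewrite (gt_eqF k0) implybT.
Qed.

Lemma worst_case_error_ge N (x : 'I_N -> pt) (c : 'I_N -> R) :
  ((initial_error1 ^+ d - N%:R * (scale^-1 *
    Num.max (mass false) (mass true)) ^+ d)%:E <=
    worst_case_error a q r x c)%E.
Proof.
(* The orthants seen by the nodes, at most [N] of them as an image of ['I_N]. The function built on
   the complement of [B] vanishes at every node, whatever the weights. *)
pose B := [set [ffun j => a < tnth (x k) j] | k : 'I_N].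
set M := scale^-1 * _.
have M0 : 0 <= M by rewrite mulr_ge0 ?invr_ge0 ?(ltW scale_gt0)// le_max ltW//
  kernel_mass_gt0.
have Mk b : 0 <= scale^-1 * mass b <= M.
  rewrite mulr_ge0 ?invr_ge0 ?(ltW scale_gt0) ?(ltW (kernel_mass_gt0 a01 p1 r0
    b))//=.
  by rewrite ler_wpM2l ?invr_ge0 ?(ltW scale_gt0)// le_max; case: b;
    rewrite lexx ?orbT.
apply: (@le_trans _ _ (`|integral_cube (fooling_fun (~: B)) -
    \sum_(k < N) c k * fooling_fun (~: B) (x k)|)%:E); last first.
  by apply: ereal_sup_ubound; exists (fooling_fun (~: B)) => //;
    exact: fooling_unit_ball.
rewrite lee_fin [X in `|_ - X|]big1 ?subr0; last first.
  by move=> k _; rewrite fooling_eq0 ?mulr0// inE negbK; apply/imsetP; exists k.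
apply: le_trans (ler_norm _); rewrite fooling_integral.
pose w (S : orthant) := \prod_(j < d) (scale^-1 * mass (S j)).
(* Expanding the d-th power of the two-term sum in [initial_error1E] gives one term per orthant;
   those in [B] are the loss, each at most [M ^+ d]. *)
have -> : initial_error1 ^+ d = \sum_(S in B) w S + \sum_(S in ~: B) w S.
  transitivity (\sum_S w S).
    transitivity (\prod_(j < d) \sum_(b : bool) (scale^-1 * mass b)).
      rewrite -[X in _ ^+ X](card_ord d) -prodr_const.
      by apply: eq_bigr => j _; rewrite big_bool [RHS]/= -initial_error1E addrC.
    exact: (bigA_distr_bigA (fun (_ : 'I_d) b => scale^-1 * mass b)).
  by rewrite (bigID (mem B))/=; congr (_ + _); apply: eq_bigl => S;
    rewrite !inE.
rewrite lerBlDr addrC lerD2l.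
apply: (@le_trans _ _ (\sum_(S in B) M ^+ d)).
  apply: ler_sum => S _; rewrite -[X in _ ^+ X](card_ord d) -prodr_const.
  by apply: ler_prod => j _; exact: Mk.
rewrite sumr_const -[X in X <= _]mulr_natl ler_wpM2r ?exprn_ge0//.
by rewrite ler_nat (leq_trans (leq_imset_card _ _))// card_ord.
Qed.

Lemma min_error_ge N :
  ((initial_error1 ^+ d - N%:R * (scale^-1 *
    Num.max (mass false) (mass true)) ^+ d)%:E <=
    min_error a q r d N)%E.
Proof.
by apply/ereal_infP => _ [x [c [_ ->]]]; exact: worst_case_error_ge.
Qed.

Lemma initial_error_le : (initial_error a q r d <= (initial_error1 ^+ d)%:E)%E.
Proof.
apply/ereal_supP => _ [f ff <-]; rewrite lee_fin.
exact: (unit_ball_integral a01 q1 pq r0 ff).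
Qed.

(** For an admissible [N] the two error bounds give (CM)^d - N M^d <= eps (CM)^d, where CM is the
    p-norm of the kernel; dividing by M^d leaves the claim. *)
Lemma information_complexity_ge eps : 0 < eps < 1 ->
  (((1 + ((Num.max a (1 - a))^-1 - 1) `^ (r%:R * p + 1)) ^+ d * (1 - eps))%:E <=
    information_complexity a q r d eps)%E.
Proof.
move=> /andP[eps0 eps1]; apply/ereal_infP => _ [N [N0 HN] <-]; rewrite lee_fin.
set C := 1 + _.
set M := scale^-1 * Num.max (mass false) (mass true).
have M0 : 0 < M by rewrite mulr_gt0 ?invr_gt0 ?scale_gt0// lt_max
  kernel_mass_gt0.
have CM : initial_error1 = C * M.
  by rewrite -initial_error1E -mulrDr -(kernel_mass_ratio a01 p1 r0) mulrCA.
have : ((initial_error1 ^+ d - N%:R * M ^+ d)%:E <=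
  (eps * initial_error1 ^+ d)%:E)%E.
  apply: (le_trans (min_error_ge N)); apply: (le_trans HN).
  by rewrite EFinM; apply: lee_wpmul2l;
    [rewrite lee_fin ltW|exact: initial_error_le].
rewrite lee_fin CM exprMn => H.
have Md : 0 < M ^+ d by rewrite exprn_gt0.
rewrite -(ler_pM2r Md); move: H.
have -> : C ^+ d * (1 - eps) * M ^+ d =
  C ^+ d * M ^+ d - eps * (C ^+ d * M ^+ d) by ring.
lra.
Qed.

End fooling.

Theorem corollary1 (R : realType) (q : \bar R) (p : R) (r : nat) (a : R)
    (hq : (1 < q)%E) (hpq : (p%:E^-1 + q^-1 = 1)%E)
    (hr : (0 < r)%N) (ha : 0 < a < 1) :
  let C := 1 + ((Num.max a (1 - a))^-1 - 1) `^ (r%:R * p + 1) in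
  [/\ curse_of_dimensionality (fun eps d => information_complexity a q r d eps),
      1 < C &
      forall (eps : R) (d : nat), 0 < eps < 1 -> (0 < d)%N ->
        ((C ^+ d * (1 - eps))%:E <= information_complexity a q r d eps)%E].
Proof.
move=> C.
have C1 : 1 < C.
  (* Both a and 1 - a lie strictly below 1, so the base of the power is positive. *)
  rewrite /C ltrDl powR_gt0// subr_gt0 invf_gt1; case/andP: ha => a0 a1.
    by rewrite gt_max a1/= gtrBl.
  by rewrite lt_max a0.
have main (eps : R) (d : nat) : 0 < eps < 1 -> (0 < d)%N ->
    ((C ^+ d * (1 - eps))%:E <= information_complexity a q r d eps)%E.
  by move=> e01 _; exact: information_complexity_ge.
(* With eps = 1/2 the factor 1 - eps is the constant 1/2, and the exponential base is [C]. *)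
split => //; exists (1 / 2), (1 / 2), C; split => //.
move=> d d0; have -> : 1 / 2 * C ^+ d = C ^+ d * (1 - 1 / 2) by field.
by apply: main => //; apply/andP; split; lra.
Qed.
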